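(* The following problem is solvable in polynomial time: given a graph $G$, an edge $e\in E(G)$ and an even-sum function $f\colon V(G)\to\{0,1\}$, decide whether $G$ has an $f$-parity perfect forest not containing $e$.
   Context: All graphs are finite and undirected, with no parallel edges or loops. A function $f\colon V(G)\to\{0,1\}$ is even-sum if $\sum_{v\in V(G)} f(v)$ is even. An $f$-parity perfect forest of $G$ is a spanning forest $H$ of $G$ such that every tree (connected component) of $H$ is an induced subgraph of $G$ and $d_H(x)\equiv f(x)\pmod 2$ for all $x\in V(G)$, where $d_H(x)$ is the degree of $x$ in $H$. *)

(* Defs.v *)
(* Plain MathComp. *)
From mathcomp Require Import all_boot.

Set Implicit Arguments.
Unset Strict Implicit.
Unset Printing Implicit Defensive.

Record sgraph (V : finType) := SGraph {
  adj :> rel V;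
  adj_sym : symmetric adj;
  adj_irr : irreflexive adj
}.

Section Graphs.
Variable V : finType.
Implicit Types (G H : sgraph V) (f : V -> bool).

Definition edges G : {set {set V}} :=
  [set [set p.1; p.2] | p : V * V & G p.1 p.2].

Definition degree G (x : V) : nat := #|[set y | G x y]|.

Definition component G (x : V) : {set V} := [set y | connect G x y].

(* [ucycle] also holds of [::] and of [:: x; y] for every edge xy, whereas the
   cycles of a simple graph have length at least 3. *)
Definition acyclic G : Prop := forall s : seq V, ucycle G s -> size s < 3.

(* H and G share the vertex type V, so every subgraph below is spanning. *)
Definition spanning_subgraph H G : Prop := edges H \subset edges G.

Definition spanning_forest H G : Prop := spanning_subgraph H G /\ acyclic H.

Definition same_edges_on (C : {set V}) H G : Prop :=
  {in C &, forall x y, H x y = G x y}.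

(* {0,1} is bool, coerced to nat. *)
Definition even_sum f : bool := ~~ odd (\sum_(v : V) f v).

Definition parity_perfect_forest G f H : Prop :=
  [/\ spanning_forest H G,
      forall x, same_edges_on (component H x) H G
    & forall x, degree H x = f x %[mod 2]].

End Graphs.

(* Random access machines, with the arithmetic, transfer and indirect
   addressing instructions of Cook and Reckhow (Time bounded random access
   machines, 1973).  Registers are indexed by nat and hold naturals of
   arbitrary size; subtraction is truncated.  Each instruction costs one unit
   of time.  As addition is the only operation that increases values, t steps
   produce numbers with at most t more bits than the constants of the program
   and the input length, so that this time measure is polynomially related to
   logarithmic cost and to Turing machine time. *)
Inductive instr :=
  | IConst of nat & nat          (* X_i := c *)
  | IAdd of nat & nat & nat      (* X_i := X_j + X_k *)
  | ISub of nat & nat & nat      (* X_i := X_j - X_k *)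
  | ILoad of nat & nat           (* X_i := X_(X_j) *)
  | IStore of nat & nat          (* X_(X_i) := X_j *)
  | IJump of nat & nat.          (* goto l if X_j > 0 *)

Definition program := seq instr.
Definition memory := nat -> nat.
Definition config := (nat * memory)%type.

Definition upd (X : memory) (i v : nat) : memory := [eta X with i |-> v].

Definition exec_instr (a : instr) (c : config) : config :=
  let: (pc, X) := c in
  match a with
  | IConst i k => (pc.+1, upd X i k)
  | IAdd i j k => (pc.+1, upd X i (X j + X k))
  | ISub i j k => (pc.+1, upd X i (X j - X k))
  | ILoad i j  => (pc.+1, upd X i (X (X j)))
  | IStore i j => (pc.+1, upd X (X i) (X j))
  | IJump j l  => (if 0 < X j then l else pc.+1, X)
  end.

Definition halted (P : program) (c : config) : bool := size P <= c.1.

Definition step (P : program) (c : config) : config :=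
  if onth P c.1 is Some a then exec_instr a c else c.

(* X_0 is the length of the input, X_1, X_2, ... are its bits, and all the
   other registers are 0. *)
Definition init (w : seq bool) : config :=
  (0, fun i => if i is k.+1 then nat_of_bool (nth false w k) else size w).

(* On halting, X_0 holds the answer. *)
Definition accepting (c : config) : bool := 0 < c.2 0.

(* The decision problem "given x : T, does Q x hold?", where the instances
   x : T are presented to the machine as bit strings through enc. *)
Definition poly_time_decidable (T : Type) (enc : T -> seq bool)
    (Q : T -> Prop) : Prop :=
  exists (P : program) (c k : nat), forall x : T,
    exists t : nat, let final := iter t (step P) (init (enc x)) in
      [/\ t <= c * size (enc x) ^ k + c,
          halted P final
        & accepting final <-> Q x].

(* Input graphs have vertex set {0, ..., n-1}, so that they can be encoded. *)
Record instance := Instance {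
  num_vertices : nat;
  input_graph : sgraph 'I_num_vertices;
  input_edge : {set 'I_num_vertices};
  parity_fun : 'I_num_vertices -> bool;
  edge_in : input_edge \in edges input_graph;
  parity_even : even_sum parity_fun
}.
Arguments input_graph : clear implicits.
Arguments input_edge : clear implicits.
Arguments parity_fun : clear implicits.

(* n in unary followed by a 0, the adjacency matrix row by row, the values of
   f, and the characteristic vector of the pair of ends of e. *)
Definition encode (I : instance) : seq bool :=
  let V := enum 'I_(num_vertices I) in
  nseq (num_vertices I) true ++ [:: false]
    ++ [seq input_graph I x y | x <- V, y <- V]
    ++ [seq parity_fun I x | x <- V]
    ++ [seq x \in input_edge I | x <- V].

(* Main.v *)
Require Import Defs.
From mathcomp Require Import all_boot.
From mathcomp Require Import zify.
From Stdlib Require Import Classical.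

(** Existence of parity perfect forests is a matter of parity alone.  Among the
    subgraphs of G whose degrees are congruent to f, one with fewest edges is
    an f-parity perfect forest: if it contained a cycle, or a path joining the
    ends of a further edge of G, then flipping (deleting or adding) the edges
    of the resulting cycle would keep all degree parities and lose edges.  Such
    a subgraph exists iff f has even sum on every component of G
    ([join_exists], [join_shrinks_to_forest]).

    Now let e = xy.  A perfect forest avoids e iff it puts x and y in different
    trees, because the trees are induced.  Deleting a vertex v leaves a set
    [around v] of vertices that still reach an end of e; its complement is the
    piece of G that hangs at v.  Call v a block vertex if no other vertex
    separates it from e; these are the vertices of the block of G containing e,
    and the pieces that hang at them partition the component of e.
    [avoidableP] says that, when all components have even sum, e can be avoided
    iff the block vertices whose pieces have odd sum are not exactly x and y.

    If they are exactly x and y, then every block vertex v has, in any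
    subgraph with degree parities f, a number of edges leaving its piece that
    is odd for v = x, y and even otherwise.  Applying the handshake lemma to
    the block vertices in the tree of x shows that y is in that tree
    ([forest_avoidable]).  Conversely, suppose that every perfect forest uses e.
    If V(G) splits into two sides, one connected and containing x, the other
    containing y, and all components on both sides have even sum, then perfect
    forests of the sides form one that avoids e ([even_split]).  So every
    connected set A containing x but not y leads to a split with odd sides
    ([sides_odd]).  For a block vertex v other than x and y, growing A
    carefully produces two such splits that differ in the piece of v only, so
    this piece has even sum ([around_pivot], [par_around]).

    The criterion is evaluated by computing polynomially many reachable sets.
    To produce a machine program for it, a small language of bounded
    iterations over natural numbers is compiled to register machine code with
    a static polynomial time bound ([compile_correct], [cost_poly],
    [expr_poly_time]).  Vertex sets are stored as the numbers whose binary
    digits are their characteristic vectors, so that the whole algorithm is one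
    closed expression, [avoidableE]. *)

Set Implicit Arguments.
Unset Strict Implicit.
Unset Printing Implicit Defensive.

(** * Parity subgraphs and their reduction to perfect forests *)
Section ParityForests.
Variable V : finType.
Implicit Types (G H : sgraph V) (f : V -> bool) (A B : {set V}).

Definition par f A : bool := \big[addb/false]_(v in A) f v.

Lemma odd_sum (I : Type) (r : seq I) (P : pred I) (F : I -> nat) :
  odd (\sum_(i <- r | P i) F i) = \big[addb/false]_(i <- r | P i) odd (F i).
Proof. exact: (big_morph odd oddD). Qed.

Lemma par_addb f1 f2 A : par (fun v => f1 v (+) f2 v) A = par f1 A (+) par f2 A.
Proof. exact: big_split. Qed.

Lemma par_pred1 u A : par (fun v => v == u) A = (u \in A).
Proof.
rewrite /par; case: (boolP (u \in A)) => [uA|uA].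
  by rewrite (bigD1 u uA) /= eqxx big1 // => v /andP[_ /negbTE].
by rewrite big1 // => v vA; apply: contraNF uA => /eqP <-.
Qed.

Lemma par_disjointU f A B : [disjoint A & B] ->
  par f (A :|: B) = par f A (+) par f B.
Proof.
move=> dAB; rewrite /par -bigU /=; last exact: dAB.
by apply: eq_bigl => v; rewrite !inE.
Qed.

Lemma degreeE H v : degree H v = \sum_w H v w.
Proof.
rewrite /degree -sum1_card big_mkcond; apply: eq_bigr => w _.
by rewrite inE; case: (H v w).
Qed.

Lemma adj_neq G x y : G x y -> x != y.
Proof. by move=> Gxy; apply/eqP=> E; rewrite E adj_irr in Gxy. Qed.

Lemma in_edges H x y : ([set x; y] \in edges H) = H x y.
Proof.
apply/imsetP/idP => [[[a b]]|Hxy]; last by exists (x, y); rewrite ?inE.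
rewrite inE /= => Hab E.
have ab := adj_neq Hab.
have := set21 x y; have := set22 x y; rewrite E !inE.
have := set21 a b; have := set22 a b; rewrite -E !inE.
move=> bE aE /orP[] /eqP yE /orP[] /eqP xE; subst => //.
- by move: bE; rewrite orbb eq_sym (negbTE ab).
- by rewrite adj_sym.
- by move: aE; rewrite orbb (negbTE ab).
Qed.

Lemma edges_sub H G : (edges H \subset edges G) <-> subrel H G.
Proof.
split=> [/subsetP HG x y Hxy|HG]; first by rewrite -in_edges HG ?in_edges.
apply/subsetP=> e /imsetP[[a b]]; rewrite inE /= => Hab ->.
by rewrite in_edges HG.
Qed.

(** The symmetric difference of H with the single edge ab. *)
Definition flip_rel H a b : rel V := fun u v =>
  H u v (+) [&& u != v, u \in pred2 a b & v \in pred2 a b].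

Lemma flip_sym H a b : symmetric (flip_rel H a b).
Proof.
move=> u v.
by rewrite /flip_rel adj_sym eq_sym andbCA (andbC (v \in _)) andbCA.
Qed.

Lemma flip_irr H a b : irreflexive (flip_rel H a b).
Proof. by move=> u; rewrite /flip_rel adj_irr eqxx. Qed.

Definition flip H a b := SGraph (flip_sym H a b) (flip_irr H a b).

Lemma degree_flip H a b v : a != b ->
  degree (flip H a b) v + H a b * ((v == a) + (v == b)) =
  degree H v + ~~ H a b * ((v == a) + (v == b)).
Proof.
move=> ab; have ba : b != a by rewrite eq_sym.
have at_end x y : x != y -> H x y = H a b -> pred2 a b =i pred2 x y ->
    degree (flip H a b) x + H a b = degree H x + ~~ H a b.
  move=> xy HE abE; rewrite !degreeE (bigD1 y) //= [in RHS](bigD1 y) //=.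
  rewrite (eq_bigr (fun w => (H x w : nat))) => [|w wy].
    by rewrite /flip_rel !abE !inE xy !eqxx orbT HE; lia.
  rewrite /flip_rel !abE !inE eqxx (negbTE wy) orbF /=.
  by case: eqVneq => [->|]; rewrite addbF.
case: (eqVneq v a) => [->|va].
  by rewrite (negbTE ab) addn0 !muln1; apply: (at_end a b).
case: (eqVneq v b) => [->|vb].
  rewrite !muln1; apply: (at_end b a); rewrite // 1?adj_sym //.
  by move=> w; rewrite !inE orbC.
rewrite !muln0 !addn0 !degreeE; apply: eq_bigr => w _.
by rewrite /= /flip_rel !inE (negbTE va) (negbTE vb) andbF addbF.
Qed.

(** Twice the number of edges, the quantity that the reduction decreases. *)
Definition arcs H := \sum_v degree H v.

Lemma arcs_flip H a b : a != b ->
  arcs (flip H a b) + H a b * 2 = arcs H + ~~ H a b * 2.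
Proof.
move=> ab; have E (c : bool) : c * 2 = \sum_v c * ((v == a) + (v == b)).
  rewrite -big_distrr /= big_split /= -!big_mkcond /=.
  by rewrite !big_pred1_eq.
by rewrite !E -!big_split; apply: eq_bigr => v _; exact: degree_flip.
Qed.

Lemma odd_degree_flip H a b v : a != b ->
  odd (degree (flip H a b) v) = odd (degree H v) (+) (v == a) (+) (v == b).
Proof.
move=> ab; have := degree_flip H v ab; move/(congr1 odd); rewrite !oddD !oddM.
rewrite !oddD !oddb; case: (H a b); case: (v == a); case: (v == b);
  case: (odd _); case: (odd _); rewrite //=.
Qed.

Lemma subrel_flip G H a b : subrel H G -> G a b -> subrel (flip H a b) G.
Proof.
move=> HG Gab u v; rewrite /= /flip_rel.
case: and3P => [[uv]|_]; last by rewrite addbF => /HG.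
rewrite !inE => /orP[] /eqP uE /orP[] /eqP vE _; subst => //.
- by rewrite eqxx in uv.
- by rewrite adj_sym.
- by rewrite eqxx in uv.
Qed.

Fixpoint flips H x p := if p is y :: p' then flips (flip H x y) y p' else H.

(** Consecutive flips along a walk cancel at its inner vertices, so only the
    parities at the two ends change, whether the steps add or remove edges. *)
Lemma odd_degree_flips G H x p v : path G x p ->
  odd (degree (flips H x p) v) = odd (degree H v) (+) (v == x) (+) (v == last x p).
Proof.
elim: p H x => [|y p IH] H x /=; first by rewrite -addbA addbb addbF.
move=> /andP[Gxy pth]; rewrite IH // odd_degree_flip ?(adj_neq Gxy) //.
by rewrite -!addbA [(v == y) (+) _]addbA addbb.
Qed.

Lemma subrel_flips G H x p : path G x p -> subrel H G -> subrel (flips H x p) G.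
Proof.
elim: p H x => [|y p IH] H x //= /andP[Gxy pth] HG.
by apply: IH => //; apply: subrel_flip.
Qed.

(** On a simple path of H every flip removes an edge: the first vertex does not
    return, so the flip of the first edge leaves the rest of the path in H. *)
Lemma arcs_flips H x p : path H x p -> uniq (x :: p) ->
  arcs (flips H x p) + size p * 2 = arcs H.
Proof.
elim: p H x => [|y p IH] H x; first by rewrite addn0.
rewrite [path _ _ _]/= => /andP[Hxy pth] /andP[xp up].
have := arcs_flip H (adj_neq Hxy); rewrite Hxy.
rewrite /= mulSn addnCA -(IH (flip H x y) y) //; first by lia.
rewrite (eq_in_path (P := predC1 x) (e' := H)) //.
  move=> u v; rewrite !inE => ux vx /=.
  rewrite /flip_rel !inE (negbTE ux) (negbTE vx) /=.
  by case: (eqVneq u y) => [->|]; rewrite ?andbF ?addbF // eq_sym andNb addbF.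
by apply/allP=> w wp; rewrite inE; apply: contraNneq xp => <-.
Qed.

(** The path together with the closing edge is a cycle of G.  Flipping it removes
    at least two edges and adds at most one, and preserves degree parities. *)
Lemma shrink G H x p : subrel H G -> path H x p -> uniq (x :: p) ->
    1 < size p -> G (last x p) x ->
  exists H', [/\ subrel H' G, arcs H' < arcs H
             & forall v, odd (degree H' v) = odd (degree H v)].
Proof.
move=> HG Hp up sp Gyx; have Gp : path G x p by apply: sub_path Hp.
exists (flip (flips H x p) (last x p) x); split.
- by apply: subrel_flip => //; apply: subrel_flips.
- have := arcs_flip (flips H x p) (adj_neq Gyx).
  by have := arcs_flips Hp up; case: (flips _ _ _ _ _); lia.
- move=> v; rewrite odd_degree_flip ?(adj_neq Gyx) // (odd_degree_flips _ _ Gp).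
  by case: (odd _); case: (_ == _); case: (_ == _).
Qed.

(** Both defects of a parity subgraph, a cycle and a tree that is not induced,
    give a path of at least two edges whose ends are adjacent in G, to which
    [shrink] applies. *)
Lemma join_shrinks_to_forest G H f : subrel H G ->
    (forall v, odd (degree H v) = f v) ->
  exists H', parity_perfect_forest G f H'.
Proof.
have [m] := ubnP (arcs H); elim: m H => // m IH H Hm HG Hf.
case: (classic (exists x p, [/\ path H x p, uniq (x :: p), 1 < size p
                              & G (last x p) x])).
  case=> x [p [Hp up sp Gyx]]; have [H' [H'G lt H'f]] := shrink HG Hp up sp Gyx.
  by apply: (IH H') => // [|v]; [lia | rewrite H'f].
move=> tight; exists H; split.
- split=> [|s]; first exact/edges_sub.
  case/andP; case: s => // x [|y p] //= /andP[Hxy].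
  rewrite rcons_path => /andP[Hp Hl] up; rewrite ltnNge; apply/negP=> sp.
  by case: tight; exists x, (y :: p); rewrite /= Hxy; split=> //; apply: HG.
- move=> z x y; rewrite !inE => zx zy; apply/idP/idP=> [/HG//|Gxy].
  have: connect H x y.
    by apply: connect_trans zy; rewrite (sym_connect_sym) // ; exact: adj_sym.
  case/connectP=> p /shortenP[[|a [|b q]] Hp up _ yE].
  + by rewrite yE /= adj_irr in Gxy.
  + by move: Hp; rewrite /= andbT yE.
  + by case: tight; exists x, [:: a, b & q]; rewrite -yE adj_sym.
- by move=> v; rewrite !modn2 Hf oddb.
Qed.

(** Two vertices with f = 1 in the same component are removed by flipping a path
    between them; this is an induction on the number of vertices with f = 1. *)
Lemma join_exists G f : (forall u, par f (component G u) = false) ->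
  exists2 H : sgraph V, subrel H G & forall v, odd (degree H v) = f v.
Proof.
have symG : connect_sym G by apply: sym_connect_sym; exact: adj_sym.
have [m] := ubnP #|[set v | f v]|; elim: m f => // m IH f fm evenf.
case: (pickP f) => [u fu|f0]; last first.
  pose e0 : rel V := fun _ _ => false.
  have s0 : symmetric e0 by []. have i0 : irreflexive e0 by [].
  exists (SGraph s0 i0) => // v; rewrite f0 degreeE big1 //.
have [w wu /andP[fw Guw]] : exists2 w, w != u & f w && connect G u w.
  apply/exists_inP; apply: contraFT (evenf u) => /exists_inPn none.
  have uu : u \in component G u by rewrite inE.
  rewrite /par (bigD1 u uu) fu big1 // => w /andP[wc wu].
  have: w \in component G u by []. rewrite inE => Guw.
  by have := none w wu; rewrite Guw andbT => /negbTE.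
have [|z|H HG Hf] := IH (fun v => f v (+) (v == u) (+) (v == w)).
- rewrite (leq_trans _ (_ : #|[set v | f v]| <= m)) //.
  apply: proper_card; apply/properP; split; last first.
    by exists u; rewrite !inE ?fu // eqxx (eq_sym u) (negbTE wu).
  apply/subsetP=> v; rewrite !inE; case: eqVneq => [->//|_].
  by case: eqVneq => [->//|_]; rewrite !addbF.
- rewrite !par_addb !par_pred1 evenf !inE (same_connect_r symG Guw).
  exact: addbb.
case/connectP: Guw => p Gp wE.
exists (flips H u p) => [|v]; first exact: subrel_flips.
rewrite (odd_degree_flips _ _ Gp) Hf -wE.
by case: (f v); case: (v == u); case: (v == w).
Qed.

End ParityForests.

(** * Reachability within a set of vertices *)
Section Reach.
Variables (V : finType) (G : sgraph V).
Implicit Types (S U A C T : {set V}).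

Definition grow S U (X : {set V}) : {set V} :=
  U :|: [set w in S | [exists u in X, G u w]].

(** Vertices reached from U by steps that end in S.  The least fixed point is by
    definition an iteration of length #|V|, which is the computation that the
    machine performs. *)
Definition reach S U : {set V} := fixset (grow S U).

Lemma grow_mono S U : {homo grow S U : X Y / X \subset Y}.
Proof.
move=> X Y /subsetP XY; apply: setUS; apply/subsetP=> w; rewrite !inE.
case/andP=> -> /exists_inP[u uX Guw]; apply/exists_inP; exists u => //.
exact: XY.
Qed.

Lemma in_reach S U w : (w \in reach S U) =
  (w \in U) || (w \in S) && [exists u in reach S U, G u w].
Proof. by rewrite /reach -{1}(fixsetK (@grow_mono S U)) !inE. Qed.

Lemma reach_src S U : U \subset reach S U.
Proof. by apply/subsetP=> w wU; rewrite in_reach wU. Qed.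

Lemma reach_step S U u w :
  u \in reach S U -> G u w -> w \in S -> w \in reach S U.
Proof.
move=> uR Guw wS; rewrite in_reach wS; apply/orP; right.
by apply/exists_inP; exists u.
Qed.

Lemma reach_min S U T : U \subset T ->
    (forall u w, u \in T -> G u w -> w \in S -> w \in T) ->
  reach S U \subset T.
Proof.
move=> UT cT; rewrite /reach /fixset; elim: #|V| => [|n IH]; first exact: sub0set.
rewrite iterS subUset UT; apply/subsetP=> w; rewrite inE.
case/andP=> wS /exists_inP[u ui Guw]; apply: cT Guw wS.
exact: (subsetP IH).
Qed.

Lemma reach_sub S U : U \subset S -> reach S U \subset S.
Proof. by move=> US; apply: reach_min. Qed.

Lemma reachS S S' U U' : S \subset S' -> U \subset U' ->
  reach S U \subset reach S' U'.
Proof.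
move=> SS' US'; apply: reach_min => [|u w uR Guw wS].
  exact: subset_trans US' (reach_src _ _).
by apply: reach_step uR Guw _; apply: (subsetP SS').
Qed.

Lemma reach_id S U : reach (reach S U) U = reach S U.
Proof.
apply/eqP; rewrite eqEsubset (reach_sub (reach_src S U)) /=.
apply: reach_min => [|u w uR Guw wS]; first exact: reach_src.
apply: (reach_step uR Guw); apply: reach_step Guw wS.
exact: (subsetP (reach_sub (reach_src S U))).
Qed.

(** The ordinary components, so that the machine can compute them as well. *)
Lemma reach_setT u : reach setT [set u] = component G u.
Proof.
apply/eqP; rewrite eqEsubset; apply/andP; split.
  apply: reach_min => [|v w]; first by rewrite sub1set inE.
  rewrite !inE => uv Gvw _; exact: connect_trans uv (connect1 Gvw).
apply/subsetP=> w; rewrite inE => /connectP[p pth ->].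
have: u \in reach setT [set u] by apply: (subsetP (reach_src _ _)); rewrite inE.
move: [set u] => W; elim: p u pth => //= v p IH u /andP[Guv pth] uR.
by apply: IH => //; apply: reach_step uR Guv _; rewrite inE.
Qed.

End Reach.

(** * The criterion for avoiding an edge *)
Section Handshake.
Variable V : finType.
Implicit Types (r : rel V) (A : {set V}).

Lemma sym_sum_even r A : symmetric r -> irreflexive r ->
  \big[addb/false]_(u in A) \big[addb/false]_(v in A) r u v = false.
Proof.
move=> rs ri; have [m] := ubnP #|A|; elim: m A => // m IH A Am.
case: (set_0Vmem A) => [->|[a aA]]; first by rewrite big_set0.
rewrite (big_setD1 a aA) (big_setD1 a aA) ri /=.
under [X in _ (+) X]eq_bigr do rewrite (big_setD1 a aA) rs.
rewrite big_split /= addbA addbb IH //.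
by move: Am; rewrite (cardsD1 a) aA.
Qed.

(** Handshake lemma for a set A: the edges inside A contribute twice. *)
Lemma par_cut (H : sgraph V) f A : (forall v, odd (degree H v) = f v) ->
  par f A = \big[addb/false]_(u in A) \big[addb/false]_(v in ~: A) H u v.
Proof.
move=> Hf; have := sym_sum_even A (adj_sym H) (adj_irr H).
move/(congr1 (addb^~ (\big[addb/false]_(u in A)
  \big[addb/false]_(v in ~: A) H u v))); rewrite addFb => <-.
rewrite -big_split; apply: eq_bigr => u _; rewrite -Hf degreeE odd_sum /=.
rewrite (bigID (mem A)) /=; congr (_ (+) _).
  by apply: eq_bigr => v _; rewrite oddb.
by apply: eq_big => v; rewrite ?inE // oddb.
Qed.
End Handshake.

Section Characterization.
Variables (V : finType) (G : sgraph V) (f : V -> bool) (e : {set V}).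

(** What still reaches an end of e when v is deleted.  If v is an end of e
    itself, only the other end remains as a source. *)
Definition around v := reach G (~: [set v]) (e :\ v).

(** For an edge e this describes the block of G that contains e: no vertex other
    than v separates v from e. *)
Definition in_block v := [forall u, (u == v) || (v \in around u)].

(** The set [around v] stands for the piece that hangs at v: the two sums have
    the same parity as soon as all components have even sum. *)
Definition avoidable :=
  [forall u, ~~ par f (reach G setT [set u])] &&
  [exists v, in_block v && (par f (around v) != (v \in e))].

Lemma around_step v u w : u \in around v -> G u w -> w != v -> w \in around v.
Proof. by move=> uv Guw wv; apply: reach_step uv Guw _; rewrite !inE. Qed.

Lemma around_src v w : w \in e -> w != v -> w \in around v.
Proof. by move=> we wv; apply: (subsetP (reach_src _ _ _)); rewrite !inE wv. Qed.

Lemma notin_around v : v \notin around v.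
Proof.
apply/negP=> va; have: around v \subset ~: [set v].
  by apply: reach_sub; apply/subsetP=> w; rewrite !inE => /andP[].
by move/subsetP/(_ v va); rewrite !inE eqxx.
Qed.

Lemma in_blockP v : reflect (forall u, u != v -> v \in around u) (in_block v).
Proof.
apply: (iffP forallP) => [H u uv|H u]; first by have := H u; rewrite (negbTE uv).
by case: eqVneq => //= uv; rewrite H.
Qed.

Lemma ends_in_block v : v \in e -> in_block v.
Proof. by move=> ve; apply/in_blockP=> u uv; apply: around_src; rewrite // eq_sym. Qed.

(** A block edge leaving the piece of v ends in another block vertex: a vertex
    that separated u from e would also separate v from e. *)
Lemma in_block_step v u : in_block v -> G v u -> u \in around v -> in_block u.
Proof.
move=> /in_blockP Bv Gvu uv; apply/in_blockP=> w wu.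
by case: (eqVneq w v) => [->//|wv]; apply: around_step (Bv _ wv) Gvu _; rewrite eq_sym.
Qed.

Lemma closed_even (H : sgraph V) (A : {set V}) : (forall v, odd (degree H v) = f v) ->
    (forall u v, u \in A -> H u v -> v \in A) -> par f A = false.
Proof.
move=> Hf cA; rewrite (par_cut _ Hf) big1 // => u uA; rewrite big1 // => v.
by rewrite inE; apply: contraNF; apply: cA.
Qed.

(** All edges between [around v] and its complement are incident with v. *)
Lemma around_cut (H : sgraph V) v :
    subrel H G -> (forall u, odd (degree H u) = f u) ->
  par f (around v) = \big[addb/false]_(u in around v) H v u.
Proof.
move=> HG Hf; rewrite (par_cut _ Hf); apply: eq_bigr => u ua.
rewrite (bigD1 v) /=; last by rewrite inE notin_around.
rewrite adj_sym big1 ?addbF // => w; rewrite inE => /andP[wa wv].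
by apply: contraNF wa => /HG Guw; apply: around_step ua Guw wv.
Qed.

(** If the criterion failed, then in the subgraph of H induced by the block edges
    exactly x and y would have odd degree, so that x and y would be in the same
    tree of H. *)
Lemma forest_avoidable (H : sgraph V) x y : e = [set x; y] -> G x y ->
  parity_perfect_forest G f H -> ~~ H x y -> avoidable.
Proof.
move=> eE Gxy [[/edges_sub HG _] ind deg] nHxy.
have Hf v : odd (degree H v) = f v.
  by have := deg v; rewrite !modn2 oddb; case: (odd _); case: (f v).
apply/andP; split.
  apply/forallP=> u; rewrite (closed_even Hf) // => a b aR /HG Gab.
  by apply: reach_step aR Gab _; rewrite inE.
apply: contraNT nHxy => /existsPn none.
have parK v : in_block v -> par f (around v) = (v \in e).
  by move=> Bv; have := none v; rewrite Bv => /negPn/eqP.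
pose A := [set v in component H x | in_block v].
have AP v : v \in A = connect H x v && in_block v by rewrite !inE.
(* The edges of H that belong to the block of e. *)
pose r v u := [&& H v u, u \in around v & v \in around u].
have rs : symmetric r by move=> v u; rewrite /r adj_sym; congr (_ && _); rewrite andbC.
have ri : irreflexive r by move=> v; rewrite /r adj_irr.
have := sym_sum_even A rs ri.
rewrite (eq_bigr (fun v => v \in e)) => [|v]; last first.
  rewrite AP => /andP[xv Bv]; rewrite -parK // (around_cut _ HG Hf).
  rewrite big_mkcond [RHS]big_mkcond; apply: eq_bigr => u _; rewrite AP /r.
  case: (boolP (H v u)) => [Hvu|_]; last by rewrite !if_same.
  have uv : u != v by rewrite eq_sym (adj_neq Hvu).
  rewrite (connect_trans xv (connect1 Hvu)) (in_blockP _ Bv u uv) andbT /=.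
  case: (boolP (u \in around v)) => [ua|_]; last by rewrite if_same.
  by rewrite (in_block_step Bv (HG _ _ Hvu) ua).
have xe : x \in e by rewrite eE set21.
have ye : y \in e by rewrite eE set22.
have xy := adj_neq Gxy.
rewrite (eq_bigr (fun v => (v == x) (+) (v == y))) => [|v _]; last first.
  by rewrite eE !inE; case: eqVneq => [->|]; rewrite ?(negbTE xy) // addbF orbF.
rewrite -/(par _ _) par_addb !par_pred1 !AP connect0.
rewrite (ends_in_block xe) (ends_in_block ye) !andbT /=.
by move/negbFE => xyc; rewrite (ind x x y) ?inE.
Qed.

Lemma component_closed (H : sgraph V) s (D : {set V}) u :
    D \subset component H s -> (forall a b, a \in D -> H a b -> b \in D) ->
  u \in D -> component H u = D.
Proof.
move=> /subsetP Ds cD uD; apply/eqP; rewrite eqEsubset; apply/andP; split.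
  rewrite -reach_setT; apply: reach_min => [|a b aD Hab _]; first by rewrite sub1set.
  exact: cD aD Hab.
apply/subsetP=> w wD; have := Ds u uD; have := Ds w wD; rewrite !inE => sw su.
by apply: connect_trans sw; rewrite sym_connect_sym //; exact: adj_sym.
Qed.

(** G without the edges between A and its complement. *)
Definition uncut_rel (A : {set V}) : rel V :=
  fun u v => G u v && ((u \in A) == (v \in A)).

Lemma uncut_sym (A : {set V}) : symmetric (uncut_rel A).
Proof. by move=> u v; rewrite /uncut_rel adj_sym eq_sym. Qed.

Lemma uncut_irr (A : {set V}) : irreflexive (uncut_rel A).
Proof. by move=> u; rewrite /uncut_rel adj_irr. Qed.

Definition uncut (A : {set V}) := SGraph (@uncut_sym A) (@uncut_irr A).

(** A component of H stays on one side of A, where the two graphs agree. *)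
Lemma uncut_forest (A : {set V}) (H : sgraph V) : parity_perfect_forest (uncut A) f H ->
  parity_perfect_forest G f H.
Proof.
case=> [[/edges_sub HG' acH] ind deg]; have HG : subrel H G by move=> u v /HG'/andP[].
split=> // [|z u v uz vz]; first by split=> //; apply/edges_sub.
rewrite (ind z u v uz vz) /= /uncut_rel.
have side w : w \in component H z -> (w \in A) = (z \in A).
  rewrite -reach_setT => wz; suff /subsetP/(_ w wz): reach H setT [set z] \subset
    [set w | (w \in A) == (z \in A)] by rewrite inE => /eqP.
  apply: reach_min => [|a b]; first by rewrite sub1set inE.
  by rewrite !inE => /eqP <- /HG'/andP[_ /eqP ->].
by rewrite !side // eqxx andbT.
Qed.

Section Split.
Variables x y : V.
Hypothesis Gxy : G x y.
Hypothesis evenG : forall u, par f (component G u) = false.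

(** Here A and C are connected and together form the component of e, so C has
    even sum as soon as A has; then all components of [uncut A] have even sum
    and a perfect forest of [uncut A] separates x from y. *)
Lemma even_split (A C : {set V}) : x \in A -> y \in C -> [disjoint A & C] ->
    A \subset reach G A [set x] -> C \subset reach G C [set y] ->
    (forall u w, u \in A :|: C -> G u w -> w \in A :|: C) ->
    par f A = false ->
  exists2 H : sgraph V, parity_perfect_forest G f H & ~~ H x y.
Proof.
move=> xA yC dAC conA conC cAC parA.
have notA u : u \in C -> (u \in A) = false by move=> uC; apply: disjointFl dAC uC.
have AG' : A \subset component (uncut A) x.
  apply: (subset_trans conA); apply: subset_trans (subsetIr A _).
  apply: reach_min => [|u w]; first by rewrite sub1set !inE xA connect0.
  rewrite !inE => /andP[uA xu] Guw wA; rewrite wA.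
  by apply: connect_trans xu (connect1 _); rewrite /= /uncut_rel Guw uA wA.
have CG' : C \subset component (uncut A) y.
  apply: (subset_trans conC); apply: subset_trans (subsetIr C _).
  apply: reach_min => [|u w]; first by rewrite sub1set !inE yC connect0.
  rewrite !inE => /andP[uC yu] Guw wC; rewrite wC.
  by apply: connect_trans yu (connect1 _); rewrite /= /uncut_rel Guw !notA.
have subG' u : component (uncut A) u \subset component G u.
  apply/subsetP=> w; rewrite !inE; apply: connect_sub => a b /andP[Gab _].
  exact: connect1.
have parAC : par f (A :|: C) = false.
  rewrite -(evenG x); congr par; apply/esym.
  apply: (component_closed (s := x)) => //; last by rewrite inE xA.
  rewrite subUset (subset_trans AG' (subG' x)); apply/subsetP=> w /(subsetP CG').
  move/(subsetP (subG' y)); rewrite !inE; exact: connect_trans (connect1 Gxy).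
have evenG' u : par f (component (uncut A) u) = false.
  case: (boolP (u \in A :|: C)) => [|uAC]; last first.
    suff -> : component (uncut A) u = component G u by [].
    apply/eqP; rewrite eqEsubset subG' -reach_setT.
    apply: (@subset_trans _ _ (component (uncut A) u :\: (A :|: C)));
      last exact: subsetDl.
    apply: reach_min => [|a b]; first by rewrite sub1set inE uAC inE connect0.
    rewrite !in_setD => /andP[aAC ua] Gab _.
    have bAC : b \notin A :|: C by apply: contra aAC => /cAC; apply; rewrite adj_sym.
    rewrite bAC; move: ua; rewrite !inE => ua.
    apply: connect_trans ua (connect1 _); rewrite /= /uncut_rel Gab.
    move: aAC bAC; rewrite !inE !negb_or => /andP[/negbTE -> _] /andP[/negbTE -> _].
    by [].
  rewrite inE => /orP[uA|uC].
    rewrite (component_closed AG') // => a b aA /andP[_ /eqP <-] //.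
  rewrite (component_closed CG') // => [|a b aC /andP[Gab /eqP E]].
    by move: parAC; rewrite par_disjointU // parA.
  have := cAC a b; rewrite !inE aC orbT => /(_ isT Gab).
  by rewrite -E (notA a aC).
have [H0 H0G H0f] := join_exists evenG'.
have [H HH] := join_shrinks_to_forest H0G H0f.
exists H; first exact: uncut_forest HH.
have [[/edges_sub HG' _] _ _] := HH; apply/negP=> /HG' /andP[_].
by rewrite xA (notA y yC).
Qed.

Lemma subset_reach_setU1 (A : {set V}) a u : A \subset reach G A [set x] ->
  a \in A -> G a u -> u |: A \subset reach G (u |: A) [set x].
Proof.
move=> conA aA Gau.
have AR : A \subset reach G (u |: A) [set x].
  by apply: subset_trans conA _; apply: reachS => //; apply: subsetUr.
rewrite subUset AR sub1set andbT.
by apply: (reach_step (subsetP AR a aA) Gau); rewrite !inE eqxx.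
Qed.

Section Forced.
Hypothesis forced : forall H : sgraph V, parity_perfect_forest G f H -> H x y.

(** Let C be the component of y in G - A, and A' the component of x in G - C.
    Then A' consists of A and of the components of G - A, other than C, that have
    a neighbour in A; as components of G - A they have no neighbour in C. *)
Lemma reach_other_side (A : {set V}) :
    x \in A -> y \notin A -> A \subset reach G A [set x] ->
  let C := reach G (~: A) [set y] in let A' := reach G (~: C) [set x] in
  [/\ C \subset ~: A, y \in C, A \subset A', A' \subset ~: C
    & forall s w, s \in A' -> w \in C -> G s w -> s \in A].
Proof.
move=> xA yA conA C A'.
have CA : C \subset ~: A by apply: reach_sub; rewrite sub1set inE.
have A'C : A' \subset ~: C.
  apply: reach_sub; rewrite sub1set; apply: contraTT xA; rewrite inE negbK.
  by move/(subsetP CA); rewrite inE.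
split=> // [||s w sA' wC Gsw].
- by apply: (subsetP (reach_src _ _ _)); rewrite inE.
- by apply: subset_trans conA _; apply: reachS => //; rewrite -setCS setCK.
apply: contraTT (subsetP A'C s sA') => sA; rewrite inE negbK.
by apply: (reach_step wC); rewrite 1?adj_sym ?inE.
Qed.

(** The sets A' and C of [reach_other_side] form the two sides of a split as in
    [even_split]; both have the same parity, since their union is a component
    of G. *)
Lemma sides_odd (A : {set V}) :
    x \in A -> y \notin A -> A \subset reach G A [set x] ->
  let C := reach G (~: A) [set y] in
  par f C /\ par f (reach G (~: C) [set x]).
Proof.
move=> xA yA conA C; have [CA yC AA' A'C _] := reach_other_side xA yA conA.
rewrite -/C in CA yC AA' A'C; set A' := reach _ (~: C) _ in AA' A'C *.
have dis : [disjoint A' & C] by rewrite disjoints_subset.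
have cl u w : u \in A' :|: C -> G u w -> w \in A' :|: C.
  rewrite !inE => /orP[uA'|uC] Guw.
    by case: (boolP (w \in C)) => wC; rewrite ?orbT // (reach_step uA' Guw) ?inE.
  case: (boolP (w \in A)) => wA; first by rewrite (subsetP AA').
  by rewrite (reach_step uC Guw) ?orbT ?inE.
have xA' : x \in A' by apply: (subsetP AA').
have parA : par f A'.
  apply/negPn/negP=> /negbTE parA'.
  have [||H HH] := even_split xA' yC dis _ _ cl parA'.
  - by rewrite reach_id.
  - by rewrite reach_id.
  - by rewrite forced.
split=> //; have := evenG x.
rewrite (@component_closed G x (A' :|: C)) ?inE ?xA' // => [|]; last first.
  rewrite -reach_setT subUset; apply/andP; split; first exact: reachS (subsetT _) _.
  apply: reach_min => [|u w uR Guw _].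
    rewrite sub1set; apply: (reach_step _ Gxy); rewrite ?inE //.
    by apply: (subsetP (reach_src _ _ _)); rewrite inE.
  by apply: (reach_step uR Guw); rewrite inE.
by rewrite par_disjointU // parA /= => /negbFE.
Qed.

Hypothesis eE : e = [set x; y].

(** The vertices, other than y, by which A can grow towards y. *)
Definition frontier (A : {set V}) : {set V} :=
  [set u in reach G (~: A) [set y] | (u != y) && [exists a in A, G a u]].

(** Write D u for the component of y when A grows by u, and choose u in the
    frontier with D u largest.  A second frontier vertex w outside D u would
    leave D u and u together on the side of y, making D w larger.  Hence u alone
    connects A with what it cuts off from y, so that these vertices form the
    piece of u, and [around u] is the disjoint union of the side of x in the
    split of A and the side D u of y in the split of u |: A.  Both are odd. *)
Lemma around_pivot (A : {set V}) :
    x \in A -> y \notin A -> A \subset reach G A [set x] -> frontier A != set0 ->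
  exists u, [/\ u \in frontier A, par f (around u) = false &
    forall v, v \in reach G (~: A) [set y] -> v \in around u ->
      v \in reach G (~: (u |: A)) [set y]].
Proof.
move=> xA yA conA /set0Pn[u0 u0N].
have [CA yC AA' A'C A'CA] := reach_other_side xA yA conA.
have [_ parA'] := sides_odd xA yA conA.
set C := reach _ (~: A) _ in CA yC AA' A'C A'CA parA' *.
set A' := reach _ (~: C) _ in AA' A'C A'CA parA'.
pose D u := reach G (~: (u |: A)) [set y].
have yD w : y \in D w by apply: (subsetP (reach_src _ _ _)); rewrite inE.
case: (arg_maxnP (P := mem (frontier A)) (fun u => #|D u|) u0N) => u uN maxu.
have NP w : w \in frontier A ->
    [/\ w \in C, w != y, w \notin A & exists2 a, a \in A & G a w].
  rewrite inE => /andP[wC /andP[wy /exists_inP[a aA Gaw]]]; split=> //; last by exists a.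
  by rewrite -in_setC (subsetP CA).
have [uC uy uA [a aA Gau]] := NP u uN.
have DuA w : w \in frontier A -> D w \subset ~: (w |: A).
  case/NP=> _ wy _ _; apply: reach_sub.
  by rewrite sub1set !inE negb_or eq_sym wy.
have DC : D u \subset C by apply: reachS; rewrite // setCS subsetUr.
have uD : u \notin D u.
  by apply/negP=> /(subsetP (DuA u uN)); rewrite !inE eqxx.
have only_u w : w \in frontier A -> w \notin D u -> w = u.
  move=> wN wD; apply/eqP; apply: contraTT (maxu w wN) => wu.
  have [wC wy wA _] := NP w wN.
  rewrite -ltnNge (cardsD1 u (D w)).
  have DD : D u \subset D w.
    apply: (@subset_trans _ _ (D u :&: D w)); last exact: subsetIr.
    apply: reach_min => [|s t].
      by rewrite sub1set inE !(subsetP (reach_src _ _ _)) ?inE.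
    rewrite !in_setI => /andP[su sw] Gst tS.
    have tu := reach_step su Gst tS; rewrite tu; apply: (reach_step sw Gst).
    move: tS; rewrite !inE !negb_or => /andP[_ ->]; rewrite andbT.
    by apply: contraNneq wD => <-.
  have [s sD Gsu] : exists2 s, s \in D u & G s u.
    apply/exists_inP; apply: contraNT uD => /exists_inPn none.
    apply: (subsetP _ u uC); apply: reach_min => [|s t sD Gst tA].
      exact: reach_src.
    apply: (reach_step sD Gst); rewrite in_setC in_setU1 negb_or -in_setC tA andbT.
    by apply: contraNneq (none s sD) => <-.
  have uDw : u \in D w.
    by apply: (reach_step (subsetP DD s sD) Gsu); rewrite !inE negb_or eq_sym wu.
  rewrite uDw ltnS; apply: subset_leq_card; apply/subsetP=> t tD.
  by rewrite in_setD1 (subsetP DD) // andbT; apply: contraTneq tD => ->.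
have aroundE : around u = A' :|: D u.
  apply/eqP; rewrite eqEsubset; apply/andP; split.
    apply: reach_min => [|s w].
      apply/subsetP=> w; rewrite eE !inE => /andP[_ /orP[] /eqP->].
        by rewrite (subsetP AA').
      by rewrite yD orbT.
    rewrite !in_setU !in_setC in_set1 => /orP[sA'|sD] Gsw wu.
      case: (boolP (w \in C)) => wC; last by rewrite (reach_step sA' Gsw) ?inE.
      case: (boolP (w \in D u)) => wD; first by rewrite orbT.
      case/eqP: wu; apply: only_u => //; rewrite inE wC /=.
      apply/andP; split; last by apply/exists_inP; exists s => //; apply: A'CA wC Gsw.
      by apply: contraNneq wD => ->.
    case: (boolP (w \in A)) => wA; first by rewrite (subsetP AA').
    by rewrite (reach_step sD Gsw) ?orbT // !inE negb_or wu.
  rewrite subUset; apply/andP; split; apply: reachS.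
  - by rewrite setCS sub1set.
  - by rewrite sub1set eE !inE eqxx andbT; apply: contraNneq uA => <-.
  - by rewrite setCS subsetUl.
  - by rewrite sub1set eE !inE eqxx orbT andbT eq_sym.
exists u; split=> // [|v vC].
  rewrite aroundE par_disjointU ?parA'; last first.
    by rewrite disjoints_subset (subset_trans A'C) // setCS.
  have [//|||-> _] := @sides_odd (u |: A); rewrite ?inE ?xA ?orbT //.
    by rewrite negb_or eq_sym uy.
  exact: subset_reach_setU1 aA Gau.
rewrite aroundE inE => /orP[/(subsetP A'C)|//].
by rewrite inE vC.
Qed.

(** For v = x take A = {x}, for v = y take A = [around y].  For another block
    vertex v take a connected A, as large as possible, with v still in the
    component of y in G - A.  If the pivot u of A were not v, then v would be
    in [around u] and hence on the side of y after adding u, so A could grow. *)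
Lemma par_around v : in_block v -> par f (around v) = (v \in e).
Proof.
move=> Bv; have xy := adj_neq Gxy; have yx : y != x by rewrite eq_sym.
case: (eqVneq v x) => [->|vx].
  have [|||par1 _] := @sides_odd [set x]; rewrite ?inE ?eqxx //.
    exact: reach_src.
  rewrite eE !inE eqxx orTb -[RHS]par1 /around eE; congr (par f (reach G _ _)).
  by apply/setP=> w; rewrite !inE; case: eqVneq => [->|] //=; rewrite (negbTE xy).
have aroundy : around y = reach G (~: [set y]) [set x].
  rewrite /around eE; congr reach; apply/setP=> w; rewrite !inE.
  by case: eqVneq => [->|] //=; rewrite ?orbF // eq_sym (negbTE xy).
case: (eqVneq v y) => [->|vy].
  have xa : x \in around y by apply: around_src; rewrite // eE set21.
  have conA : around y \subset reach G (around y) [set x] by rewrite aroundy reach_id.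
  have [_ parA] := sides_odd xa (notin_around _) conA.
  have [_ yC AA' _ _] := reach_other_side xa (notin_around _) conA.
  rewrite eE !inE eqxx orbT -[RHS]parA; congr par; apply/eqP; rewrite eqEsubset AA'.
  by rewrite aroundy; apply: reachS; rewrite // setCS sub1set -aroundy.
pose P (A : {set V}) := [&& x \in A, y \notin A, A \subset reach G A [set x]
  & v \in reach G (~: A) [set y]].
have Px : P [set x].
  rewrite /P !inE eqxx yx reach_src /=.
  have vx' : v \in around x by apply: (in_blockP _ Bv); rewrite eq_sym.
  have sub : around x \subset reach G (~: [set x]) [set y].
    apply: reachS => //; rewrite eE; apply/subsetP=> w.
    by rewrite !inE => /andP[/negbTE ->].
  exact: (subsetP sub).
case: (arg_maxnP (fun A : {set V} => #|A|) Px) => A /and4P[xA yA conA vC] maxA.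
have [CA yC AA' A'C A'CA] := reach_other_side xA yA conA.
set C := reach _ (~: A) _ in CA yC AA' A'C A'CA vC.
have [u [uN paru uC]] : exists u, [/\ u \in frontier A, par f (around u) = false &
    forall v, v \in C -> v \in around u -> v \in reach G (~: (u |: A)) [set y]].
  (* An empty frontier would mean that y separates v from x. *)
  apply: around_pivot => //; apply/negP=> /eqP N0.
  have := in_blockP _ Bv y; rewrite eq_sym vy => /(_ isT); rewrite aroundy.
  apply/negP; apply: contraL vC => va; rewrite -in_setC.
  have: v \in reach G (~: C) [set x].
    apply: (subsetP _ v va); apply: reach_min => [|s w sA' Gsw wy].
      exact: reach_src.
    case: (boolP (w \in C)) => [wC|wC]; last by apply: reach_step sA' Gsw _; rewrite inE.
    have sA := A'CA s w sA' wC Gsw.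
    have := in_set0 w; rewrite -N0 inE wC andTb.
    have -> : [exists a in A, G a w] by apply/exists_inP; exists s.
    by rewrite andbT; move: wy; rewrite !inE => ->.
  exact: (subsetP A'C).
case: (eqVneq u v) => [uv|uv].
  by rewrite -uv paru uv eE !inE (negbTE vx) (negbTE vy).
move: uN; rewrite inE => /andP[uCC /andP[uy /exists_inP[a aA Gau]]].
have uA : u \notin A by rewrite -in_setC (subsetP CA).
have Pu : P (u |: A).
  rewrite /P !inE xA orbT (negbTE yA) orbF eq_sym uy (subset_reach_setU1 conA aA) //=.
  by apply: uC => //; apply: (in_blockP _ Bv).
by have := maxA _ Pu; rewrite /= cardsU1 uA add1n ltnn.
Qed.

End Forced.
End Split.

Theorem avoidableP : e \in edges G ->
  (exists H : sgraph V, parity_perfect_forest G f H /\ e \notin edges H)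
  <-> avoidable.
Proof.
case/imsetP=> [[x y]]; rewrite inE /= => Gxy eE; split.
  case=> H [HH]; rewrite eE in_edges; exact: forest_avoidable HH.
case/andP=> /forallP even_comp /existsP[v /andP[Bv odd_v]].
have evenG u : par f (component G u) = false.
  by rewrite -reach_setT; apply/negbTE.
apply: NNPP => none; case/negP: odd_v; rewrite (par_around Gxy) // => H HH.
by apply/negPn/negP=> nHxy; apply: none; exists H; rewrite eE in_edges.
Qed.

End Characterization.

(** * Executing straight pieces of machine code *)
Section Runs.
Variable P : program.

Definition runs (c : config) (t : nat) (c' : config) := iter t (step P) c = c'.

Definition code_at (pc : nat) (s : program) :=
  exists s1 s2, P = s1 ++ s ++ s2 /\ size s1 = pc.

Lemma runs_trans t1 t2 c1 c2 c3 :
  runs c1 t1 c2 -> runs c2 t2 c3 -> runs c1 (t1 + t2) c3.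
Proof. by rewrite /runs addnC iterD => -> ->. Qed.

Lemma code_at_catl pc s1 s2 : code_at pc (s1 ++ s2) -> code_at pc s1.
Proof. by case=> a [b [E <-]]; exists a, (s2 ++ b); rewrite E !catA. Qed.

Lemma code_at_catr pc s1 s2 : code_at pc (s1 ++ s2) -> code_at (pc + size s1) s2.
Proof.
by case=> a [b [E <-]]; exists (a ++ s1), b; rewrite size_cat E !catA.
Qed.

Lemma code_at_tail pc i s : code_at pc (i :: s) -> code_at pc.+1 s.
Proof. by rewrite -addn1; apply: (@code_at_catr pc [:: i]). Qed.

Lemma run_instr pc i s X : code_at pc (i :: s) ->
  runs (pc, X) 1 (exec_instr i (pc, X)).
Proof.
case=> a [b [E <-]]; rewrite /runs /= /step /=.
by rewrite E onth_cat ltnn subnn.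
Qed.

Lemma run_cons pc i s X t c : code_at pc (i :: s) ->
  runs (exec_instr i (pc, X)) t c -> runs (pc, X) t.+1 c.
Proof. by move=> /run_instr H1 H2; apply: runs_trans (H1 X) H2. Qed.

End Runs.

Local Arguments upd : simpl never.

Lemma upd_eq X i v : upd X i v i = v.
Proof. by rewrite /upd /= eqxx. Qed.

Lemma upd_neq X i v j : j != i -> upd X i v j = X j.
Proof. by rewrite /upd /= => /negbTE ->. Qed.

(** * A language of bounded iterations *)

(** Every expression has a value: [Iter] is primitive recursion whose number of
    rounds is capped by the input length, which makes the time bound static.
    The last arguments of [App] and [Iter] are the only values that the body
    can access, so bodies are closed functions and may be reused without
    renaming variables. *)
Inductive expr :=
  | Var of nat
  | Cst of nat
  | Len
  | Plus of expr & expr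
  | Minus of expr & expr
  | Read of expr
  | App of expr & seq expr
  | Iter of expr & expr & expr & seq expr.

(** Expressions occur in lists within expressions, for which the generated
    induction principle gives no hypothesis. *)
Section ExprInd.
Variable Q : expr -> Prop.
Hypothesis QVar : forall i, Q (Var i).
Hypothesis QCst : forall c, Q (Cst c).
Hypothesis QLen : Q Len.
Hypothesis QPlus : forall a b, Q a -> Q b -> Q (Plus a b).
Hypothesis QMinus : forall a b, Q a -> Q b -> Q (Minus a b).
Hypothesis QRead : forall a, Q a -> Q (Read a).
Hypothesis QApp : forall f s, Q f -> foldr (fun a => and (Q a)) True s -> Q (App f s).
Hypothesis QIter : forall m a f s, Q m -> Q a -> Q f ->
  foldr (fun a => and (Q a)) True s -> Q (Iter m a f s).

Fixpoint expr_nested_ind (e : expr) : Q e :=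
  let fix all_ind (s : seq expr) : foldr (fun a => and (Q a)) True s :=
    if s is a :: s' then conj (expr_nested_ind a) (all_ind s') else I in
  match e with
  | Var i => QVar i
  | Cst c => QCst c
  | Len => QLen
  | Plus a b => QPlus (expr_nested_ind a) (expr_nested_ind b)
  | Minus a b => QMinus (expr_nested_ind a) (expr_nested_ind b)
  | Read a => QRead (expr_nested_ind a)
  | App f s => QApp (expr_nested_ind f) (all_ind s)
  | Iter m a f s => QIter (expr_nested_ind m) (expr_nested_ind a)
                      (expr_nested_ind f) (all_ind s)
  end.
End ExprInd.

Section Eval.
Variables (L : nat) (rd : nat -> nat).

(** The input is accessed through rd.  In the body of [Iter], variable 0 is the
    round, variable 1 the accumulator, and the parameters start at 2. *)
Fixpoint eval (env : seq nat) (e : expr) {struct e} : nat :=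
  match e with
  | Var i => nth 0 env i
  | Cst c => c
  | Len => L
  | Plus a b => eval env a + eval env b
  | Minus a b => eval env a - eval env b
  | Read a => rd (eval env a)
  | App f s => eval (map (eval env) s) f
  | Iter m a f s =>
      let vs := map (eval env) s in
      iteri (minn (eval env m) L) (fun i acc => eval [:: i, acc & vs] f)
            (eval env a)
  end.

(** A bound on the number of machine steps. *)
Fixpoint cost (e : expr) : nat :=
  match e with
  | Var _ | Cst _ | Len => 2
  | Plus a b | Minus a b => cost a + cost b + 1
  | Read a => cost a + 5
  | App f s => foldr (fun a => addn (cost a)) 0 s + cost f + 2
  | Iter m a f s =>
      cost m + cost a + foldr (fun a => addn (cost a)) 0 s + L * (cost f + 6) + 10
  end.
End Eval.

(** A bound on the number of registers that the compiled code overwrites. *)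
Fixpoint width (e : expr) : nat :=
  match e with
  | Var _ | Cst _ | Len => 1
  | Plus a b | Minus a b => width a + width b + 1
  | Read a => width a
  | App f s => foldr (fun a => addn (width a)) 1 s + size s + width f
  | Iter m a f s =>
      width m + width a + foldr (fun a => addn (width a)) 1 s + size s + width f + 3
  end.

(** * Compilation *)

(** The machine has no copy instruction, so X_d is cleared first; this requires
    that d and s differ. *)
Definition move_code (d s : nat) : program := [:: IConst d 0; IAdd d d s].

(** X_d holds the number of rounds, X_(d+1) the current round and X_(d+2) the
    accumulator; register r receives the result of the body c. *)
Definition loop_code (d r pc : nat) (c : program) : program :=
  [:: ISub 2 d d.+1; IJump 2 (pc + 3); IJump 1 (pc + 3 + size c + 4)] ++
  c ++ move_code d.+2 r ++ [:: IAdd d.+1 d.+1 1; IJump 1 pc].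

Lemma size_loop_code d r pc c : size (loop_code d r pc c) = size c + 7.
Proof. by rewrite /loop_code !size_cat /=; lia. Qed.

Definition compile_args (comp : nat -> nat -> expr -> program) :=
  fix comps (d pc : nat) (s : seq expr) : program :=
    if s is a :: s' then
      let c := comp d pc a in c ++ comps d.+1 (pc + size c) s'
    else [::].

(** The k variables are in the registers from b on, registers from d on are free,
    and the result goes to register d.  Jumps are absolute, so the address pc of
    the code is needed.  Registers 0, 1, 3 and 4 hold constants described by
    [reserved], and register 2 is scratch.  Capping the rounds at L uses that
    L - (L - m) is the minimum of m and L.  The input registers below X_4 have
    been moved up by X_3, whence the case distinction for [Read]. *)
Fixpoint compile (b k d pc : nat) (e : expr) {struct e} : program :=
  match e with
  | Var i => if i < k then move_code d (b + i) else [:: IConst d 0]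
  | Cst c => [:: IConst d c]
  | Len => move_code d 0
  | Plus a a' =>
      let c := compile b k d pc a in
      c ++ compile b k d.+1 (pc + size c) a' ++ [:: IAdd d d d.+1]
  | Minus a a' =>
      let c := compile b k d pc a in
      c ++ compile b k d.+1 (pc + size c) a' ++ [:: ISub d d d.+1]
  | Read a =>
      let c := compile b k d pc a in
      let pc1 := pc + size c in
      c ++ [:: ISub 2 4 d; IJump 2 (pc1 + 3); IJump 1 (pc1 + 4);
               IAdd d d 3; ILoad d d]
  | App f s =>
      let c := compile_args (compile b k) d pc s in
      let r := (d + size s).+1 in
      c ++ compile d (size s) r (pc + size c) f ++ move_code d r
  | Iter m a f s =>
      let c1 := compile b k d pc m ++ [:: ISub 2 0 d; ISub d 0 2] in
      let pc1 := pc + size c1 in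
      let c2 := compile b k d.+2 pc1 a in
      let pc2 := pc1 + size c2 in
      let c3 := compile_args (compile b k) d.+3 pc2 s ++ [:: IConst d.+1 0] in
      let pc3 := pc2 + size c3 in
      let r := d.+3 + size s in
      let c4 := compile d.+1 (size s).+2 r (pc3 + 3) f in
      c1 ++ c2 ++ c3 ++ loop_code d r pc3 c4 ++ move_code d d.+2
  end.

Section Correctness.
Variables (P : program) (K L : nat) (rd : nat -> nat).

(** The registers below K belong to the compiled code, and the input that was
    stored there is found K + L places further up.  The function rd hides this
    relocation: it gives the bits at their original addresses. *)
Definition reserved (X : memory) : Prop :=
  [/\ X 0 = L, X 1 = 1, X 3 = K + L, X 4 = K
    & forall p, X (if p < K then p + (K + L) else p) = rd p].

(** Code writing to w registers from d on may also destroy register 2. *)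
Definition frame (d w : nat) (X X' : memory) : Prop :=
  forall j, j != 2 -> (j < d) || (d + w <= j) -> X' j = X j.

Lemma frame_trans d w X1 X2 X3 : frame d w X1 X2 -> frame d w X2 X3 -> frame d w X1 X3.
Proof. by move=> H12 H23 j j2 jd; rewrite H23 // H12. Qed.

Lemma frame_sub d w d' w' X X' : d <= d' -> d' + w' <= d + w ->
  frame d' w' X X' -> frame d w X X'.
Proof. by move=> dd ww H j j2 jd; apply: H => //; lia. Qed.

Lemma frame_upd d w X i v : (i == 2) || (d <= i < d + w) -> frame d w X (upd X i v).
Proof. by move=> iw j j2 jd; rewrite upd_neq //; lia. Qed.

Lemma reserved_frame d w X X' : 5 <= d -> d + w <= K ->
  frame d w X X' -> reserved X -> reserved X'.
Proof.
move=> d5 wK fr [X0 X1 X3 X4 Xrd].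
by split=> [||||p]; rewrite fr //; do ?case: ifP; lia.
Qed.

Definition env_at (b : nat) (env : seq nat) (X : memory) :=
  forall i, i < size env -> X (b + i) = nth 0 env i.

Lemma env_frame b env d w X X' : b + size env <= d -> 5 <= b ->
  frame d w X X' -> env_at b env X -> env_at b env X'.
Proof. by move=> bd b5 fr H i iX; rewrite fr ?H //; lia. Qed.

Definition correct (e : expr) := forall b d pc X env,
  code_at P pc (compile b (size env) d pc e) ->
  5 <= b -> b + size env <= d -> d + width e <= K ->
  env_at b env X -> reserved X ->
  exists t X', [/\ t <= cost L e,
    runs P (pc, X) t (pc + size (compile b (size env) d pc e), X'),
    X' d = eval L rd env e & frame d (width e) X X'].

Lemma width_gt0 e : 0 < width e.
Proof. by elim/expr_nested_ind: e => //= *; lia. Qed.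

Lemma run_move pc d s X : code_at P pc (move_code d s) -> d != s ->
  exists X', [/\ runs P (pc, X) 2 (pc + 2, X'), X' d = X s & frame d 1 X X'].
Proof.
move=> C ds; exists (upd (upd X d 0) d (upd X d 0 d + upd X d 0 s)); split.
- by apply: (run_cons C); rewrite addn2; apply: (run_instr _ (code_at_tail C)).
- by rewrite !upd_eq upd_neq // eq_sym.
- by move=> j j2 jd; rewrite !upd_neq //; lia.
Qed.

Definition args_correct (s : seq expr) := forall b d pc X env,
  code_at P pc (compile_args (compile b (size env)) d pc s) ->
  5 <= b -> b + size env <= d ->
  d + (foldr (fun a => addn (width a)) 1 s + size s) <= K ->
  env_at b env X -> reserved X ->
  exists t X', [/\ t <= foldr (fun a => addn (cost L a)) 0 s,
    runs P (pc, X) t (pc + size (compile_args (compile b (size env)) d pc s), X'),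
    env_at d (map (eval L rd env) s) X'
    & frame d (foldr (fun a => addn (width a)) 1 s + size s) X X'].

Lemma compile_args_correct s :
  foldr (fun a => and (correct a)) True s -> args_correct s.
Proof.
elim: s => [|a s IH] /=; first by move=> _ b d pc X env C b5 bd wK eX rX;
  exists 0, X; split; rewrite ?addn0.
case=> Ca /IH{}IH b d pc X env /= C b5 bd wK eX rX.
have [|t1 [X1 [T1 R1 V1 F1]]] := Ca b d pc X env (code_at_catl C) b5 bd _ eX rX.
  by lia.
have [||||t2 [X2 [T2 R2 V2 F2]]] := IH b d.+1 _ X1 env (code_at_catr C) b5.
- by lia.
- by lia.
- exact: env_frame F1 eX.
- by apply: reserved_frame F1 rX; lia.
exists (t1 + t2), X2; split.
- by lia.
- by rewrite size_cat addnA; apply: runs_trans R1 R2.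
- case=> [|i] iX; last by rewrite -addSnnS; apply: V2.
  by rewrite addn0 F2 /= ?V1 //; lia.
- apply: (frame_trans (X2 := X1)); first by apply: frame_sub F1; lia.
  by apply: frame_sub F2; lia.
Qed.

Lemma reserved_upd2 X v : 4 < K -> reserved X -> reserved (upd X 2 v).
Proof.
move=> K4 [X0 X1 X3 X4 Xrd]; split=> [||||p]; rewrite upd_neq //.
by case: ifP; lia.
Qed.

(** The loop is entered with rounds 0, ..., i - 1 done and n rounds left. *)
Lemma run_loop f d m n pc X vs a i : correct f ->
    let F i acc := eval L rd [:: i, acc & vs] f in
    let c := compile d.+1 (size vs).+2 (d.+3 + size vs) (pc + 3) f in
    code_at P pc (loop_code d (d.+3 + size vs) pc c) ->
    5 <= d -> d.+3 + size vs + width f <= K ->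
    X d = m -> env_at d.+1 [:: i, iteri i F a & vs] X -> reserved X -> i + n = m ->
  exists t X', [/\ t <= n * (cost L f + 6) + 3,
    runs P (pc, X) t (pc + size (loop_code d (d.+3 + size vs) pc c), X'),
    X' d.+2 = iteri m F a & frame d.+1 (2 + size vs + width f) X X'].
Proof.
move=> Cf F c C d5 wK; rewrite size_loop_code.
have -> : pc + (size c + 7) = pc + 3 + size c + 4 by lia.
elim: n X i => [|n IH] X i Xd eX rX inm.
  have X1 : X 1 = 1 by case: rX.
  have Xi := eX 0 isT; have Xacc := eX 1 isT; rewrite /= ?addn0 ?addn1 in Xi Xacc.
  exists 3, (upd X 2 (X d - X d.+1)); split=> //.
  - apply: (run_cons C); rewrite /= Xd Xi.
    have -> : m - i = 0 by lia.
    apply: (run_cons (code_at_tail C)); rewrite /=.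
    have := run_instr (upd X 2 0) (code_at_tail (code_at_tail C)).
    by rewrite /= upd_neq // X1.
  - by rewrite upd_neq ?Xacc; [congr iteri|]; lia.
  - by apply: frame_upd.
have X1 : X 1 = 1 by case: rX.
have Xi := eX 0 isT; have Xacc := eX 1 isT; rewrite /= ?addn0 ?addn1 in Xi Xacc.
pose X2 := upd X 2 (m - i).
have F2 : frame d.+3 0 X X2 by apply: frame_upd.
have R2 : runs P (pc, X) 2 (pc + 3, X2).
  apply: (run_cons C); rewrite /= Xd Xi -/X2.
  have := run_instr X2 (code_at_tail C); rewrite [exec_instr _ _]/=.
  by rewrite {2}/X2 upd_eq subn_gt0; have -> : i < m by lia.
have r2 : reserved X2 by apply: reserved_upd2 => //; lia.
have e2 : env_at d.+1 [:: i, iteri i F a & vs] X2.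
  by move=> j jX; rewrite /X2 upd_neq ?eX //; lia.
have C1 := code_at_catr C; rewrite [size _]/= in C1.
have [|||t3 [X3 [T3 R3 V3 F3]]] :=
  Cf d.+1 (d.+3 + size vs) _ _ [:: i, iteri i F a & vs] (code_at_catl C1) _ _ _ e2 r2.
- by lia.
- by rewrite /=; lia.
- by lia.
rewrite -/c in R3.
have r3 : reserved X3 by apply: reserved_frame F3 r2; lia.
have C2 := code_at_catr C1.
have [|X4 [R4 V4 F4]] := run_move X3 (code_at_catl C2); first by lia.
have C3 := code_at_catr C2; rewrite [size _]/= in C3.
pose X5 := upd X4 d.+1 i.+1.
have keep4 j : j != 2 -> j < d.+2 -> X4 j = X j.
  by move=> j2 jd; rewrite F4 ?F3 ?F2 //; lia.
have R5 : runs P (pc + 3 + size c + 2, X4) 2 (pc, X5).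
  apply: (run_cons C3); rewrite [exec_instr _ _]/= !keep4 //; try lia.
  rewrite Xi X1 addn1 -/X5.
  have := run_instr X5 (code_at_tail C3); rewrite [exec_instr _ _]/=.
  by rewrite {2}/X5 upd_neq ?keep4 ?X1 //; lia.
have F5 : frame d.+1 (2 + size vs + width f) X X5.
  move=> j j2 jd; rewrite /X5 upd_neq; last by lia.
  by rewrite F4 ?F3 ?F2 //; lia.
have [||||t6 [X6 [T6 R6 V6 F6]]] := IH X5 i.+1.
- by rewrite F5 //; lia.
- case=> [|[|j]] jX.
  + by rewrite addn0 /X5 upd_eq.
  + by rewrite addn1 /X5 upd_neq ?V4 ?V3 //; lia.
  + rewrite /= in jX; rewrite /X5 upd_neq ?F4 ?F3 ?F2 ?eX //=; lia.
- by apply: reserved_frame F5 rX; lia.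
- by lia.
exists (2 + t3 + 2 + 2 + t6), X6; split=> //.
- by lia.
- apply: runs_trans R6; apply: runs_trans R5; apply: runs_trans R4.
  exact: runs_trans R2 R3.
- exact: frame_trans F5 F6.
Qed.

Lemma compile_binop (op : nat -> nat -> nat) (I : nat -> nat -> nat -> instr)
    b d pc X env a1 a2 :
    (forall i j k pc X,
       exec_instr (I i j k) (pc, X) = (pc.+1, upd X i (op (X j) (X k)))) ->
    correct a1 -> correct a2 ->
    let c1 := compile b (size env) d pc a1 in
    let c := c1 ++ compile b (size env) d.+1 (pc + size c1) a2 ++ [:: I d d d.+1] in
    code_at P pc c -> 5 <= b -> b + size env <= d ->
    d + (width a1 + width a2 + 1) <= K -> env_at b env X -> reserved X ->
  exists t X', [/\ t <= cost L a1 + cost L a2 + 1, runs P (pc, X) t (pc + size c, X'),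
    X' d = op (eval L rd env a1) (eval L rd env a2)
    & frame d (width a1 + width a2 + 1) X X'].
Proof.
move=> Iop C1 C2 c1 c C b5 bd wK eX rX; rewrite {}/c in C *.
have [|t1 [X1 [T1 R1 V1 F1]]] := C1 b d pc X env (code_at_catl C) b5 bd _ eX rX.
  by lia.
have C' := code_at_catr C.
have [||||t2 [X2 [T2 R2 V2 F2]]] := C2 b d.+1 _ X1 env (code_at_catl C') b5.
- by lia.
- by lia.
- exact: env_frame F1 eX.
- by apply: reserved_frame F1 rX; lia.
have := run_instr X2 (code_at_catr C'); rewrite Iop => R3.
have w1 := width_gt0 a1.
exists (t1 + t2 + 1), (upd X2 d (op (X2 d) (X2 d.+1))); split.
- by lia.
- rewrite !size_cat !addnA [size [:: _]]/= [X in (X, upd _ _ _)]addn1.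
  by apply: runs_trans R3; apply: runs_trans R1 R2.
- by rewrite upd_eq V2 F2 ?V1 //; lia.
- by move=> j j2 jd; rewrite upd_neq ?F2 ?F1 //; lia.
Qed.

Lemma foldr_width_gt0 s : 0 < foldr (fun a => addn (width a)) 1 s.
Proof. by elim: s => //= a s IH; rewrite addn_gt0 IH orbT. Qed.

(* Simplification would merge the instruction lists and hide the pieces of code. *)
Local Opaque loop_code move_code.

Lemma compile_iter m a f s : correct m -> correct a -> correct f ->
  foldr (fun a => and (correct a)) True s -> correct (Iter m a f s).
Proof.
move=> Cm Ca Cf Cs b d pc X env /=.
set c1 := _ ++ [:: ISub 2 0 d; _]; set pc1 := pc + size c1.
set c2 := compile b (size env) d.+2 pc1 a; set pc2 := pc1 + size c2.
set c3 := compile_args _ _ pc2 s ++ _; set pc3 := pc2 + size c3.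
set vs := map _ s; have sz : size s = size vs by rewrite size_map.
rewrite !sz; set c4 := compile d.+1 _ _ _ f => C b5 bd wK eX rX.
set N := minn _ L.
have ws := foldr_width_gt0 s.
have C1 := code_at_catl C; have C' := code_at_catr C; rewrite -/pc1 in C'.
have C2 := code_at_catl C'; have {}C' := code_at_catr C'; rewrite -/pc2 in C'.
have C3 := code_at_catl C'; have {}C' := code_at_catr C'; rewrite -/pc3 in C'.
have C4 := code_at_catl C'; have C5 := code_at_catr C'.
have [||t1 [X1 [T1 R1 V1 F1]]] := Cm b d pc X env (code_at_catl C1) b5 _ _ eX rX.
- by lia.
- by lia.
have r1 : reserved X1 by apply: reserved_frame F1 rX; lia.
have [L1 _ _ _ _] := r1.
pose X2 := upd (upd X1 2 (L - X1 d)) d (L - (L - X1 d)).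
have R2 : runs P (pc + size (compile b (size env) d pc m), X1) 2 (pc1, X2).
  have D := code_at_catr C1; apply: (run_cons D); rewrite [exec_instr _ _]/= L1.
  have := run_instr (upd X1 2 (L - X1 d)) (code_at_tail D).
  rewrite [exec_instr _ _]/= upd_eq upd_neq // L1.
  by rewrite /pc1 size_cat addnA addn2.
have F2 : frame d 1 X1 X2 by move=> j j2 jd; rewrite /X2 !upd_neq //; lia.
have N2 : X2 d = N by rewrite /X2 upd_eq V1 /N; lia.
have r2 : reserved X2 by apply: reserved_frame F2 r1; lia.
have e2 : env_at b env X2 by apply: env_frame F2 (env_frame _ _ F1 eX).
have [||t3 [X3 [T3 R3 V3 F3]]] := Ca b d.+2 pc1 X2 env C2 b5 _ _ e2 r2.
- by lia.
- by lia.
have r3 : reserved X3 by apply: reserved_frame F3 r2; lia.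
have e3 : env_at b env X3 by apply: env_frame F3 e2 => //; lia.
have [||t4 [X4 [T4 R4 V4 F4]]] :=
  compile_args_correct Cs (code_at_catl C3) b5 _ _ e3 r3.
- by lia.
- by lia.
have r4 : reserved X4 by apply: reserved_frame F4 r3; lia.
pose X5 := upd X4 d.+1 0.
have R5 : runs P (pc2 + size (compile_args (compile b (size env)) d.+3 pc2 s), X4) 1
              (pc3, X5).
  have := run_instr X4 (code_at_catr C3); rewrite [exec_instr _ _]/=.
  by rewrite /pc3 size_cat addnA addn1.
have F5 : frame d.+1 1 X4 X5 by apply: frame_upd; lia.
have r5 : reserved X5 by apply: reserved_frame F5 r4; lia.
have V5 : env_at d.+1 [:: 0, eval L rd env a & vs] X5.
  case=> [|[|j]] jX.
  - by rewrite addn0 /X5 upd_eq.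
  - by rewrite addn1 F5 ?F4 ?V3 //; lia.
  - by rewrite -[RHS]V4 // F5 ?addSnnS ?addSn //; lia.
have [|||t6 [X6 [T6 R6 V6 F6]]] :=
  @run_loop f d N N pc3 X5 vs (eval L rd env a) 0 Cf C4 _ _ _ V5 r5 (add0n N).
- by lia.
- by lia.
- by rewrite F5 ?F4 ?F3 ?N2 //; lia.
have [|X7 [R7 V7 F7]] := run_move X6 C5; first by lia.
have NL : N * (cost L f + 6) <= L * (cost L f + 6) by rewrite leq_mul2r geq_minr orbT.
exists (t1 + 2 + t3 + t4 + 1 + t6 + 2), X7; split.
- by lia.
- set c5 := loop_code _ _ _ _ in R6 *.
  have -> : pc + size (c1 ++ c2 ++ c3 ++ c5 ++ move_code d d.+2) = pc3 + size c5 + 2.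
    by rewrite (size_cat c1) (size_cat c2) (size_cat c3) (size_cat c5) !addnA.
  apply: runs_trans R7; apply: runs_trans R6; apply: runs_trans R5.
  apply: runs_trans R4; apply: runs_trans R3; exact: runs_trans R1 R2.
- by rewrite V7 V6.
- move=> j j2 jd; rewrite F7 ?F6 ?F5 ?F4 ?F3 ?F2 ?F1 //; lia.
Qed.

Local Transparent loop_code move_code.

Lemma compile_correct e : correct e.
Proof.
elim/expr_nested_ind: e =>
  [i|n||a1 a2 C1 C2|a1 a2 C1 C2|a Ca|f s Cf Cs|m a f s Cm Ca Cf Cs];
  last exact: compile_iter; move=> b d pc X env /= C b5 bd wK eX rX.
- case: ltnP => iX in C *.
    have [|X' [R V F]] := run_move X C; first by lia.
    by exists 2, X'; split=> //; rewrite V eX.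
  exists 1, (upd X d 0); split=> //.
  + by rewrite addn1; apply: (run_instr _ C).
  + by rewrite upd_eq nth_default.
  + by apply: frame_upd; lia.
- exists 1, (upd X d n); split=> //.
  + by rewrite addn1; apply: (run_instr _ C).
  + by rewrite upd_eq.
  + by apply: frame_upd; lia.
- have [|X' [R V F]] := run_move X C; first by lia.
  by exists 2, X'; split=> //; rewrite V; case: rX.
- exact: (compile_binop (op := addn) (I := IAdd)).
- exact: (compile_binop (op := subn) (I := ISub)).
- have [t1 [X1 [T1 R1 V1 F1]]] := Ca b d pc X env (code_at_catl C) b5 bd wK eX rX.
  have wa := width_gt0 a.
  have C0 := code_at_catr C; set p := pc + _ in C0 R1 *.
  have r1 : reserved X1 by apply: reserved_frame F1 rX; lia.
  have K4 : 4 < K by lia.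
  pose X2 := upd X1 2 (K - X1 d).
  have r2 : reserved X2 by exact: reserved_upd2.
  have [_ Y1 Y3 Y4 Yrd] := r2.
  have Xd : X2 d = eval L rd env a by rewrite /X2 upd_neq ?V1 //; lia.
  set v := eval L rd env a in Xd *.
  have R2 : runs P (p, X1) 1 (p.+1, X2).
    have := run_instr X1 C0; rewrite [exec_instr _ _]/=.
    by have [_ _ _ -> _] := r1.
  pose X3 := if v < K then upd X2 d (v + (K + L)) else X2.
  have [t3 [T3 R3]] : exists t3, t3 <= 3 /\ runs P (p.+1, X2) t3 (p.+4, X3).
    have C1 := code_at_tail C0; have C2 := code_at_tail C1; have C3 := code_at_tail C2.
    have := run_instr X2 C1; rewrite [exec_instr _ _]/= {2}/X2 upd_eq subn_gt0 V1 -/v.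
    rewrite /X3; case: ltnP => vK RJ.
      exists 2; split=> //; apply: runs_trans RJ _; rewrite addn3.
      have := run_instr X2 C3; rewrite [exec_instr _ _]/=.
      by rewrite Xd Y3.
    exists 2; split=> //; apply: runs_trans RJ _.
    by have := run_instr X2 C2; rewrite [exec_instr _ _]/= Y1 addn4.
  have C4 := code_at_tail (code_at_tail (code_at_tail (code_at_tail C0))).
  have R4 := run_instr X3 C4.
  exists (t1 + 1 + t3 + 1), (upd X3 d (X3 (X3 d))); split.
  + by lia.
  + have -> : pc + size (compile b (size env) d pc a ++ [:: ISub 2 4 d;
        IJump 2 (p + 3); IJump 1 (p + 4); IAdd d d 3; ILoad d d]) = p.+4.+1.
      by rewrite size_cat /= addnA -/p !addnS addn0.
    apply: runs_trans R4; apply: runs_trans R3; apply: runs_trans R2; exact: R1.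
  + rewrite upd_eq -Yrd /X3; case: ltnP => vK; rewrite ?upd_eq ?Xd // upd_neq //; lia.
  + move=> j j2 jd; rewrite upd_neq; last by lia.
    by rewrite /X3 /X2; case: ifP => _; rewrite !upd_neq ?F1 //; lia.
- have [|t1 [X1 [T1 R1 V1 F1]]] :=
    compile_args_correct Cs (code_at_catl C) b5 bd _ eX rX; first by lia.
  set vs := map _ s in V1 *.
  have sz : size s = size vs by rewrite size_map.
  have C1 := code_at_catr C; rewrite !sz in C1 F1 wK *.
  set p := pc + _ in C1 R1 *.
  have ws := foldr_width_gt0 s.
  have [||||t2 [X2 [T2 R2 V2 F2]]] := Cf d _ _ X1 vs (code_at_catl C1) _ _ _ V1.
  + by lia.
  + by lia.
  + by lia.
  + by apply: reserved_frame F1 rX; lia.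
  have wf := width_gt0 f.
  have [|X3 [R3 V3 F3]] := run_move X2 (code_at_catr C1); first by lia.
  exists (t1 + t2 + 2), X3; split; first by lia.
  + rewrite !size_cat !addnA; apply: runs_trans R3; exact: runs_trans R1 R2.
  + by rewrite V3.
  + move=> j j2 jd; rewrite F3 ?F2 ?F1 //; lia.
Qed.

End Correctness.

(** * From expressions to polynomial time *)

(** Register 2 is used to compute the target addresses; its own content is a bit
    of the input, which is lost. *)
Definition save_code (K : nat) (s : seq nat) : program :=
  flatten [seq [:: IConst 2 (K + i); IAdd 2 2 0; IStore 2 i] | i <- s].

Definition prologue (K : nat) : program :=
  save_code K (iota 3 (K - 3)) ++ [:: IConst 3 K; IAdd 3 3 0; IConst 4 K].

(** Targets lie at K + L + 3 and above, beyond both the sources and the input,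
    so nothing that is still needed gets overwritten. *)
Lemma run_save P K L s pc X : code_at P pc (save_code K s) -> X 0 = L ->
    {in s, forall i, 2 < i < K} ->
  exists X', runs P (pc, X) (3 * size s) (pc + size (save_code K s), X') /\
    forall j, j != 2 -> X' j = if (K + L <= j) && (j - (K + L) \in s)
                               then X (j - (K + L)) else X j.
Proof.
elim: s pc X => [|i s IH] pc X C XL sK.
  by exists X; split; [rewrite addn0 | move=> j _; rewrite andbF].
have /andP[i2 iK] := sK i (mem_head i s).
pose X1 := upd (upd (upd X 2 (K + i)) 2 (K + i + L)) (K + i + L) (X i).
have C1 := code_at_tail C; have C2 := code_at_tail C1.
have R1 : runs P (pc, X) 3 (pc.+3, X1).
  apply: (run_cons C); rewrite [exec_instr _ _]/=.
  apply: (run_cons C1); rewrite [exec_instr _ _]/= upd_eq upd_neq // XL.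
  have := run_instr (upd (upd X 2 (K + i)) 2 (K + i + L)) C2.
  by rewrite [exec_instr _ _]/= [upd _ 2 _ i]upd_neq ?[upd _ 2 _ i]upd_neq //; lia.
have [||X2 [R2 E2]] := IH pc.+3 X1 (code_at_tail C2).
- by rewrite /X1 !upd_neq //; lia.
- by move=> j js; apply: sK; rewrite inE js orbT.
exists X2; split.
  have -> : 3 * size (i :: s) = 3 + 3 * size s by rewrite /=; lia.
  have -> : pc + size (save_code K (i :: s)) = pc.+3 + size (save_code K s).
    by rewrite /save_code /=; lia.
  exact: runs_trans R1 R2.
move=> j j2; rewrite E2 // inE.
have X1E k : k != 2 -> k != K + i + L -> X1 k = X k.
  by move=> k2 ki; rewrite /X1 !upd_neq.
case: (leqP (K + L) j) => [KLj|jKL] /=; last by rewrite X1E //; lia.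
case: (boolP (j - (K + L) \in s)) => [js|_].
  rewrite orbT X1E //.
    by have := sK (j - (K + L)); rewrite inE js orbT; lia.
  by have := sK (j - (K + L)); rewrite inE js orbT; lia.
rewrite orbF; case: eqVneq => [ji|ji]; last by rewrite X1E //; lia.
have -> : j = K + i + L by lia.
by rewrite /X1 upd_eq; congr X; lia.
Qed.

(** Registers 1 and 2 are not saved.  Register 1 is left alone, its content 1
    being a constant that the compiled code needs. *)
Lemma run_prologue P K L X : 4 < K -> code_at P 0 (prologue K) ->
    X 0 = L -> X 1 = 1 ->
    (forall j, L < j -> X j = 0) ->
  exists X' rd, [/\ runs P (0, X) (3 * (K - 2)) (size (prologue K), X'),
    reserved K L rd X' & forall p, 2 < p <= L -> rd p = X p].
Proof.
move=> K4 C X0 X1 XL.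
have [|X' [R E]] := run_save (code_at_catl C) X0.
  by move=> i; rewrite mem_iota; lia.
pose Y := upd (upd (upd X' 3 K) 3 (K + L)) 4 K.
exists Y, (fun p => Y (if p < K then p + (K + L) else p)); split.
- have C1 := code_at_catr C; rewrite add0n in C1.
  have C2 := code_at_tail C1; have C3 := code_at_tail C2.
  have -> : 3 * (K - 2) = 3 * size (iota 3 (K - 3)) + 3 by rewrite size_iota; lia.
  apply: runs_trans R _; rewrite add0n.
  apply: (run_cons C1); rewrite [exec_instr _ _]/=.
  apply: (run_cons C2); rewrite [exec_instr _ _]/=.
  have := run_instr (upd (upd X' 3 K) 3 (K + L)) C3.
  have -> : upd X' 3 K 3 + upd X' 3 K 0 = K + L.
    by rewrite upd_eq upd_neq // E // X0; case: ifP => //; lia.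
  by rewrite [exec_instr _ _]/= /prologue size_cat addn3.
- split=> //.
  + by rewrite /Y !upd_neq // E // X0; case: ifP; lia.
  + by rewrite /Y !upd_neq // E // X1; case: ifP; lia.
- move=> p /andP[p2 pL]; rewrite /Y !upd_neq; try by case: ifP; lia.
  rewrite E; last by case: ifP; lia.
  rewrite mem_iota; case: ltnP => pK.
    by rewrite leq_addl addnK; case: ifP => //; lia.
  by case: ifP => //; lia.
Qed.

Definition program_of (e : expr) : program :=
  let K := 5 + width e in
  let p := prologue K in
  p ++ compile 5 0 5 (size p) e ++ move_code 0 5.

(** The first input bit has to be 1, as it serves as the constant in register 1. *)
Lemma program_of_correct e (w : seq bool) : nth false w 0 ->
  exists rd t, [/\ forall p, 1 < p < size w -> rd p.+1 = nth false w p :> nat,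
    t <= cost (size w) e + 3 * (5 + width e)
    & let final := iter t (step (program_of e)) (init w) in
      halted (program_of e) final /\
      accepting final = (0 < eval (size w) rd [::] e)].
Proof.
move=> w0; set K := 5 + width e; set L := size w; set P := program_of e.
have C : code_at P 0 P by exists [::], [::]; rewrite cats0.
have C' := code_at_catr C; rewrite add0n in C'.
have w_gt0 := width_gt0 e.
have [||||X1 [rd [R1 r1 rdE]]] := @run_prologue P K L (init w).2 _ (code_at_catl C).
- by lia.
- by [].
- by rewrite /= w0.
- by case=> // j jL; rewrite /= nth_default.
have [||t2 [X2 [T2 R2 V2 F2]]] :=
  @compile_correct P K L rd e 5 5 _ X1 [::] (code_at_catl C') isT isT _ _ r1.
- by rewrite /K; lia.
- by [].
have [|X3 [R3 V3 F3]] := run_move X2 (code_at_catr C'); first by [].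
exists rd, (3 * (K - 2) + t2 + 2); split.
- by move=> p pw; rewrite rdE //=; lia.
- by rewrite /K; lia.
rewrite -/P /init -[(0, _)]/(0, (init w).2) (runs_trans (runs_trans R1 R2) R3).
rewrite /halted /accepting /= V3 V2; split=> //.
by rewrite /P /program_of !size_cat addnA.
Qed.

Lemma cost_poly e : exists c k, forall L, cost L e <= c * L.+1 ^ k.
Proof.
pose poly (T : nat -> nat) := exists c k, forall L, T L <= c * L.+1 ^ k.
have polyD T1 T2 : poly T1 -> poly T2 -> poly (fun L => T1 L + T2 L).
  case=> c1 [k1 H1] [c2 [k2 H2]]; exists (c1 + c2), (k1 + k2) => L.
  rewrite mulnDl; apply: leq_add; [apply: leq_trans (H1 L) _|apply: leq_trans (H2 L) _];
    by rewrite leq_mul2l leq_pexp2l ?orbT ?leq_addr ?leq_addl.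
have polyC c : poly (fun=> c) by exists c, 0 => L; rewrite muln1.
have polyM T : poly T -> poly (fun L => L * T L).
  case=> c [k H]; exists c, k.+1 => L; rewrite expnS mulnCA.
  by apply: leq_mul.
have polyS s : foldr (fun a => and (poly (cost^~ a))) True s ->
    poly (fun L => foldr (fun a => addn (cost L a)) 0 s).
  by elim: s => [|a s IH] /= => [_|[Ca /IH]]; [apply: polyC | apply: polyD].
change (poly (cost^~ e)).
elim/expr_nested_ind: e =>
  [i|n||a b Ca Cb|a b Ca Cb|a Ca|f s Cf Cs|m a f s Cm Ca Cf Cs] /=.
- exact: polyC.
- exact: polyC.
- exact: polyC.
- exact: (polyD _ _ (polyD _ _ Ca Cb) (polyC 1)).
- exact: (polyD _ _ (polyD _ _ Ca Cb) (polyC 1)).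
- exact: (polyD _ _ Ca (polyC 5)).
- exact: (polyD _ _ (polyD _ _ (polyS s Cs) Cf) (polyC 2)).
- have loop := polyM _ (polyD _ _ Cf (polyC 6)).
  have pre := polyD _ _ (polyD _ _ Cm Ca) (polyS s Cs).
  exact: (polyD _ _ (polyD _ _ pre loop) (polyC 10)).
Qed.

Lemma time_poly e C : exists c k, forall L, cost L e + C <= c * L ^ k + c.
Proof.
have [c [k H]] := cost_poly e; exists (c * 2 ^ k + C), k => L.
have := H L; case: (posnP L) => [->|L0].
  rewrite exp1n => H0; have : 0 < 2 ^ k by rewrite expn_gt0.
  by nia.
move=> HL; have : L.+1 ^ k <= 2 ^ k * L ^ k.
  by rewrite -expnMn; have [->//|k0] := posnP k; rewrite leq_exp2r //; lia.
by nia.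
Qed.

(** The bit of index p is at rd p.+1, as register 0 holds the input length.  The
    first two bits are excluded because their registers are reused. *)
Theorem expr_poly_time (T : Type) (enc : T -> seq bool) (Q : T -> Prop) e :
    (forall x, nth false (enc x) 0) ->
    (forall x rd,
       (forall p, 1 < p < size (enc x) -> rd p.+1 = nth false (enc x) p :> nat) ->
       0 < eval (size (enc x)) rd [::] e <-> Q x) ->
  poly_time_decidable enc Q.
Proof.
move=> enc0 eQ; have [c [k ck]] := time_poly e (3 * (5 + width e)).
exists (program_of e), c, k => x.
have [rd [t [rdE tT [hal acc]]]] := program_of_correct e (enc0 x).
exists t; split; [exact: leq_trans tT (ck _) | exact: hal | rewrite acc; exact: eQ].
Qed.

(** * Arithmetic, logic and sets of vertices as expressions *)
Definition bNot a := Minus (Cst 1) a.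
Definition bAnd a b := Minus (Plus a b) (Cst 1).
Definition bOr a b := bNot (bAnd (bNot a) (bNot b)).
Definition bLeq a b := bNot (Minus a b).
Definition bEq a b := bAnd (bLeq a b) (bLeq b a).

(** In these binders f sees the index as variable 0 and the values of s from
    variable 2 on; variable 1 is the partial sum, on which f must not depend. *)
Definition sumE n f s := Iter n (Cst 0) (Plus (Var 1) f) s.
Definition existsE n f s := bNot (bNot (sumE n f s)).
Definition forallE n f s := bNot (existsE n (bNot f) s).

Definition pow2E := Iter (Var 0) (Cst 1) (Plus (Var 1) (Var 1)) [::].
Definition mulE := Iter (Var 0) (Cst 0) (Plus (Var 1) (Var 2)) [:: Var 1].
Definition parityE := Iter (Var 0) (Cst 0) (bNot (Var 1)) [::].
Definition comprE n f s := sumE n (App mulE [:: f; App pow2E [:: Var 0]]) s.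

(** One round of [memE]: at round i the binary digit of index L - 1 - i is
    cleared. *)
Definition trimE :=
  let p := App pow2E [:: Minus Len (Plus (Var 0) (Cst 1))] in
  Minus (Var 1) (App mulE [:: bLeq p (Var 1); p]).

(** Variables are a vertex a and the code of a set.  Clearing all digits above
    the digit of index a leaves a number that is at least 2 ^ a iff this digit
    is 1. *)
Definition memE :=
  bLeq (App pow2E [:: Var 0])
       (Iter (Minus Len (Plus (Var 0) (Cst 1))) (Var 1) trimE [::]).

Definition bits (b : nat -> bool) k := \sum_(i < k) b i * 2 ^ i.

Lemma bitsS b k : bits b k.+1 = bits b k + b k * 2 ^ k.
Proof. by rewrite /bits big_ord_recr. Qed.

Lemma bits_lt b k : bits b k < 2 ^ k.
Proof.
elim: k => [|k IH]; first by rewrite /bits big_ord0.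
by rewrite bitsS expnS; case: (b k); lia.
Qed.

Lemma bits_top b k : (2 ^ k <= bits b k.+1) = b k.
Proof. by rewrite bitsS; have := bits_lt b k; case: (b k); lia. Qed.

Lemma bits_widen b n m : n <= m -> (forall i, n <= i -> ~~ b i) ->
  bits b n = bits b m.
Proof.
move=> /subnK <- b0; elim: (m - n) => //= k ->.
by rewrite addSn bitsS (negbTE (b0 _ _)) ?addn0 // leq_addl.
Qed.

Definition code n (A : {set 'I_n}) := \sum_(i < n) (i \in A) * 2 ^ i.

(** For a digit sequence indexed by nat, prefixes are easy to speak about; this
    one vanishes from n on. *)
Lemma code_bits n (A : {set 'I_n}) : code A = bits (fun i => i \in image val A) n.
Proof. by apply: eq_bigr => i _; rewrite mem_image //; apply: val_inj. Qed.

Lemma code0 n : code (set0 : {set 'I_n}) = 0.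
Proof. by apply: big1 => i _; rewrite inE. Qed.

Section Spec.
Variables (L : nat) (rd : nat -> nat).
Notation ev := (eval L rd).

Lemma ev_app1 env f a x : ev env a = x -> ev env (App f [:: a]) = ev [:: x] f.
Proof. by move=> <-. Qed.

Lemma ev_app2 env f a b x y : ev env a = x -> ev env b = y ->
  ev env (App f [:: a; b]) = ev [:: x; y] f.
Proof. by move=> <- <-. Qed.

Lemma ev_app3 env f a b c x y z : ev env a = x -> ev env b = y -> ev env c = z ->
  ev env (App f [:: a; b; c]) = ev [:: x; y; z] f.
Proof. by move=> <- <- <-. Qed.

Lemma ev_not env a (p : bool) : ev env a = p -> ev env (bNot a) = ~~ p.
Proof. by move=> /= ->; case: p. Qed.

Lemma ev_and env a b (p q : bool) :
  ev env a = p -> ev env b = q -> ev env (bAnd a b) = p && q.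
Proof. by move=> /= -> ->; case: p; case: q. Qed.

Lemma ev_or env a b (p q : bool) :
  ev env a = p -> ev env b = q -> ev env (bOr a b) = p || q.
Proof.
move=> ap bq.
by rewrite (ev_not (ev_and (ev_not ap) (ev_not bq))) negb_and !negbK.
Qed.

Lemma ev_leq env a b m n :
  ev env a = m -> ev env b = n -> ev env (bLeq a b) = (m <= n).
Proof. by move=> /= -> ->; case: leqP => /=; lia. Qed.

Lemma ev_eq env a b m n :
  ev env a = m -> ev env b = n -> ev env (bEq a b) = (m == n).
Proof. by move=> am bn; rewrite (ev_and (ev_leq am bn) (ev_leq bn am)) eqn_leq. Qed.

(** The general way to evaluate an iteration: guess the sequence x of
    accumulator values. *)
Lemma ev_iter (x : nat -> nat) N env m a f s : ev env m = N -> N <= L ->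
    ev env a = x 0 ->
    (forall i, i < N -> ev [:: i, x i & map (ev env) s] f = x i.+1) ->
  ev env (Iter m a f s) = x N.
Proof.
move=> /= -> NL -> xS; rewrite (minn_idPl NL).
by elim: {-2}N (leqnn N) => //= i IH iN; rewrite IH ?xS // ltnW.
Qed.

Lemma ev_sum N (F : 'I_N -> nat) env n f s : ev env n = N -> N <= L ->
    (forall (i : 'I_N) acc, ev [:: val i, acc & map (ev env) s] f = F i) ->
  ev env (sumE n f s) = \sum_i F i.
Proof.
move=> nN NL fF; rewrite (ev_iter (x := fun k => \sum_(i < N | i < k) F i) nN NL).
- by apply: eq_bigl => i; rewrite ltn_ord.
- by rewrite big_pred0.
- move=> i iN; rewrite [LHS]/= (fF (Ordinal iN)).
  rewrite [RHS](bigD1 (Ordinal iN)) //= addnC; congr (_ + _).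
  by apply: eq_bigl => j; rewrite ltnS ltn_neqAle andbC.
Qed.

Lemma ev_exists N (p : pred 'I_N) env n f s : ev env n = N -> N <= L ->
    (forall (i : 'I_N) acc, ev [:: val i, acc & map (ev env) s] f = p i) ->
  ev env (existsE n f s) = [exists i, p i].
Proof.
move=> nN NL fp; rewrite /existsE [LHS]/=.
rewrite -[iteri _ _ _]/(ev env (sumE n f s)) (ev_sum nN NL fp).
case: existsP => [[i pi]|np]; first by rewrite (bigD1 i) //= pi.
by rewrite big1 // => i _; case: (boolP (p i)) => // pi; case: np; exists i.
Qed.

Lemma ev_forall N (p : pred 'I_N) env n f s : ev env n = N -> N <= L ->
    (forall (i : 'I_N) acc, ev [:: val i, acc & map (ev env) s] f = p i) ->
  ev env (forallE n f s) = [forall i, p i].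
Proof.
move=> nN NL fp; rewrite (ev_not (ev_exists (p := fun i => ~~ p i) nN NL _)).
  by rewrite -negb_forall negbK.
by move=> i acc; apply: ev_not.
Qed.

Lemma ev_pow2 k : k <= L -> ev [:: k] pow2E = 2 ^ k.
Proof.
move=> kL; rewrite (ev_iter (x := fun i => 2 ^ i) _ kL) // => i _.
by rewrite /= expnS mul2n addnn.
Qed.

Lemma ev_mul a b : a <= L -> ev [:: a; b] mulE = a * b.
Proof.
move=> aL; rewrite (ev_iter (x := fun i => i * b) _ aL) // => i _.
by rewrite /= mulSn addnC.
Qed.

Lemma ev_parity m : m <= L -> ev [:: m] parityE = odd m.
Proof.
by move=> mL; rewrite (ev_iter (x := odd) _ mL) // => i _; apply: ev_not.
Qed.

Lemma ev_compr N (p : pred 'I_N) env n f s : ev env n = N -> 0 < N <= L ->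
    (forall (i : 'I_N) acc, ev [:: val i, acc & map (ev env) s] f = p i) ->
  ev env (comprE n f s) = code [set i | p i].
Proof.
move=> nN /andP[N0 NL] fp; apply: ev_sum => // i acc.
rewrite (ev_app2 _ (fp i acc) (@ev_app1 (val i :: _) _ (Var 0) _ erefl)) inE.
rewrite ev_pow2 ?ev_mul //; first by case: (p i); lia.
by have := ltn_ord i; rewrite /=; lia.
Qed.

Lemma ev_mem N (A : {set 'I_N}) (a : 'I_N) : N <= L ->
  ev [:: val a; code A] memE = (a \in A).
Proof.
move=> NL; pose b i := i \in image val A.
have aL : a < L by apply: leq_trans NL.
have -> : (a \in A) = b a by rewrite /b mem_image //; apply: val_inj.
rewrite -(bits_top b a); apply: ev_leq.
  by rewrite (@ev_app1 (val a :: _) _ (Var 0) _ erefl) ev_pow2 // ltnW.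
rewrite (ev_iter (x := fun i => bits b (L - i)) (N := L - a.+1)).
- by congr bits; lia.
- by rewrite /= addn1.
- exact: leq_subr.
- rewrite /= subn0 code_bits; apply: bits_widen => // i Ni; apply/imageP=> -[j _ ij].
  by have := ltn_ord j; rewrite -[nat_of_ord j]/(val j) -ij; lia.
move=> i iL; rewrite [RHS]/=; set k := L - i.+1.
set env := map _ _; have {}env0 : env = [::] by [].
have pE : ev [:: i, bits b (L - i) & env]
    (App pow2E [:: Minus Len (Plus (Var 0) (Cst 1))]) = 2 ^ k.
  by rewrite (@ev_app1 _ _ _ k) ?ev_pow2 ?leq_subr //= addn1.
have kE : L - i = k.+1 by rewrite /k; lia.
have tE := ev_leq pE
  (erefl : ev [:: i, bits b (L - i) & env] (Var 1) = bits b (L - i)).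
set e1 := _ :: _; set p := App _ _ in pE tE.
rewrite (_ : ev e1 trimE =
  bits b (L - i) - ev e1 (App mulE [:: bLeq p (Var 1); p])) //.
rewrite (ev_app2 _ tE pE) ev_mul; last by apply: leq_trans (leq_b1 _) _; lia.
by rewrite kE bits_top bitsS addnK.
Qed.

End Spec.

(* From here on these functions are known by their evaluation lemmas only. *)
Local Opaque pow2E mulE parityE memE.

(** * The decision procedure *)

(** The encoding starts with n ones and a zero.  Starting from 2, which is at
    most n, the counter advances while the bit whose index is the counter is 1,
    and stays at n afterwards. *)
Definition sizeE := Iter Len (Cst 2) (Plus (Var 1) (Read (Plus (Var 1) (Cst 1)))) [::].

(** The first bit of the adjacency matrix is in register n + 2.  Here and in
    [labelE] and [endE], variable 0 is n and the others are vertices. *)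
Definition edgeE :=
  Read (Plus (Plus (Plus (Var 0) (Cst 2)) (App mulE [:: Var 1; Var 0])) (Var 2)).

Definition labelE :=
  Read (Plus (Plus (Plus (Var 0) (Cst 2)) (App mulE [:: Var 0; Var 0])) (Var 1)).

Definition endE :=
  Read (Plus (Plus (Plus (Plus (Var 0) (Cst 2)) (App mulE [:: Var 0; Var 0])) (Var 0))
             (Var 1)).

(** Variables: the round, the current set R, and the n, U, v of [reachE]. *)
Definition growE :=
  let adjacent :=
    bAnd (App memE [:: Var 0; Var 3]) (App edgeE [:: Var 4; Var 0; Var 2]) in
  let new := bOr (App memE [:: Var 0; Var 4])
    (bAnd (bNot (bEq (Var 0) (Var 5)))
          (existsE (Var 3) adjacent [:: Var 0; Var 2; Var 3])) in
  comprE (Var 2) new [:: Var 1; Var 2; Var 3; Var 4].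

(** Variables n, U, v: the vertices reached from U without entering v.  For v = n
    no vertex is forbidden. *)
Definition reachE := Iter (Var 0) (Cst 0) growE [:: Var 0; Var 1; Var 2].

Definition parE :=
  App parityE [:: sumE (Var 0) (bAnd (App memE [:: Var 0; Var 3])
    (App labelE [:: Var 2; Var 0])) [:: Var 0; Var 1]].

Definition aroundE :=
  let sources := comprE (Var 0) (bAnd (App endE [:: Var 2; Var 0])
    (bNot (bEq (Var 0) (Var 3)))) [:: Var 0; Var 1] in
  App reachE [:: Var 0; sources; Var 1].

Definition in_blockE :=
  forallE (Var 0) (bOr (bEq (Var 0) (Var 3))
    (App memE [:: Var 3; App aroundE [:: Var 2; Var 0]])) [:: Var 0; Var 1].

Definition componentsE :=
  forallE (Var 0) (bNot (App parE [:: Var 2;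
    App reachE [:: Var 2; App pow2E [:: Var 0]; Var 2]])) [:: Var 0].

Definition pieceE :=
  existsE (Var 0) (bAnd (App in_blockE [:: Var 2; Var 0])
    (bNot (bEq (App parE [:: Var 2; App aroundE [:: Var 2; Var 0]])
               (App endE [:: Var 2; Var 0])))) [:: Var 0].

Definition avoidableE := App (bAnd componentsE pieceE) [:: sizeE].

Section GraphSpec.
Variables (n L : nat) (rd : nat -> nat).
Variables (G : sgraph 'I_n) (f : 'I_n -> bool) (e : {set 'I_n}).
Hypothesis n_gt1 : 1 < n.
Hypothesis nL : n < L.
Hypothesis rd_ones : forall i, 1 < i < n -> rd i.+1 = 1.
Hypothesis rd_stop : rd n.+1 = 0.
Hypothesis rd_edge : forall a b : 'I_n, rd (n + 2 + a * n + b) = G a b.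
Hypothesis rd_label : forall a : 'I_n, rd (n + 2 + n * n + a) = f a.
Hypothesis rd_end : forall a : 'I_n, rd (n + 2 + n * n + n + a) = (a \in e).
Notation ev := (eval L rd).

Let nL' : n <= L. Proof. exact: ltnW. Qed.
Let n_ok : 0 < n <= L. Proof. by lia. Qed.
Let ord_leL (a : 'I_n) : a <= L. Proof. by have := ltn_ord a; lia. Qed.

Lemma ev_size : ev [::] sizeE = n.
Proof.
rewrite (ev_iter (x := fun i => minn (2 + i) n) (N := L)) //.
- by lia.
- by rewrite /=; lia.
move=> i iL /=; rewrite addn1.
case: (ltnP (2 + i) n) => ni; first by rewrite rd_ones; lia.
by rewrite rd_stop; lia.
Qed.

Lemma ev_edge (a b : 'I_n) : ev [:: n; val a; val b] edgeE = G a b.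
Proof. by rewrite -rd_edge -(ev_mul rd n (ord_leL a)). Qed.

Lemma ev_label (a : 'I_n) : ev [:: n; val a] labelE = f a.
Proof. by rewrite -rd_label -(ev_mul rd n nL'). Qed.

Lemma ev_end (a : 'I_n) : ev [:: n; val a] endE = (a \in e).
Proof. by rewrite -rd_end -(ev_mul rd n nL'). Qed.

Lemma ev_grow (R U : {set 'I_n}) v j :
  ev [:: j; code R; n; code U; v] growE =
  code (grow G [set w | val w != v] U R).
Proof.
rewrite (@ev_compr _ _ n (fun w => w \in grow G [set w | val w != v] U R)) //.
  by congr code; apply/setP=> w; rewrite inE.
move=> w acc; rewrite !inE; apply: ev_or; first exact: ev_mem.
apply: ev_and; first by apply: ev_not; apply: ev_eq.
rewrite (@ev_exists _ _ n (fun a => (a \in R) && G a w)) // => a acc'.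
by apply: ev_and; [apply: ev_mem | apply: ev_edge].
Qed.

Lemma ev_reach (U : {set 'I_n}) v :
  ev [:: n; code U; v] reachE = code (reach G [set w | val w != v] U).
Proof.
pose X i := iter i (grow G [set w | val w != v] U) set0.
rewrite (ev_iter (N := n) (x := fun i => code (X i))) //.
- by rewrite /X /reach /fixset card_ord.
- by rewrite code0.
- by move=> i iN; apply: ev_grow.
Qed.

Lemma ev_par (R : {set 'I_n}) : ev [:: n; code R] parE = par f R.
Proof.
rewrite /parE; set e1 := [:: n; code R].
have E : ev e1 (sumE (Var 0) (bAnd (App memE [:: Var 0; Var 3])
    (App labelE [:: Var 2; Var 0])) [:: Var 0; Var 1]) = \sum_(i < n) (i \in R) && f i.
  by apply: ev_sum => // i acc; apply: ev_and; [apply: ev_mem | apply: ev_label].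
rewrite (ev_app1 _ E) ev_parity.
  rewrite /par odd_sum [in RHS]big_mkcond; congr nat_of_bool.
  by apply: eq_bigr => i _; rewrite oddb; case: (i \in R).
apply: leq_trans nL'; rewrite -[X in _ <= X]card_ord -sum1_card.
by apply: leq_sum => i _; apply: leq_b1.
Qed.

Lemma ev_around (v : 'I_n) : ev [:: n; val v] aroundE = code (around G e v).
Proof.
rewrite /aroundE; set src := comprE _ _ _.
have E : ev [:: n; val v] src = code (e :\ v).
  rewrite (@ev_compr _ _ n (fun w => w \in e :\ v)) //.
    by congr code; apply/setP=> w; rewrite inE.
  move=> w acc; rewrite in_setD1 andbC; apply: ev_and; first exact: ev_end.
  by apply: ev_not; apply: ev_eq.
rewrite (@ev_app3 _ _ [:: n; val v] _ (Var 0) _ (Var 1) _ _ _ erefl E erefl).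
rewrite ev_reach; congr (code (reach G _ _)).
by apply/setP=> w; rewrite !inE.
Qed.

Lemma ev_in_block (v : 'I_n) : ev [:: n; val v] in_blockE = in_block G e v.
Proof.
apply: ev_forall => // u acc; apply: ev_or; first exact: ev_eq.
set e1 := _ :: _.
have E : ev e1 (App aroundE [:: Var 2; Var 0]) = code (around G e u).
  exact: ev_around.
by rewrite (@ev_app2 _ _ e1 _ (Var 3) _ _ _ erefl E) ev_mem.
Qed.

Lemma ev_components :
  ev [:: n] componentsE = [forall u, ~~ par f (reach G setT [set u])].
Proof.
apply: ev_forall => // u acc; apply: ev_not; set e1 := _ :: _.
have E1 : ev e1 (App pow2E [:: Var 0]) = code [set u].
  transitivity (2 ^ u); first exact: (ev_pow2 rd (ord_leL u)).
  rewrite /code (bigD1 u) //= set11 mul1n big1 ?addn0 // => w wu.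
  by rewrite inE (negbTE wu).
have E2 : ev e1 (App reachE [:: Var 2; App pow2E [:: Var 0]; Var 2]) =
    code (reach G setT [set u]).
  rewrite (@ev_app3 _ _ e1 _ (Var 2) _ (Var 2) _ _ _ erefl E1 erefl) ev_reach.
  congr (code (reach G _ _)); apply/setP=> w; rewrite !inE.
  by rewrite neq_ltn ltn_ord.
by rewrite (@ev_app2 _ _ e1 _ (Var 2) _ _ _ erefl E2) ev_par.
Qed.

Lemma ev_piece :
  ev [:: n] pieceE = [exists v, in_block G e v && (par f (around G e v) != (v \in e))].
Proof.
apply: ev_exists => // v acc; apply: ev_and; first exact: ev_in_block.
set e1 := _ :: _.
have E1 : ev e1 (App aroundE [:: Var 2; Var 0]) = code (around G e v).
  exact: ev_around.
have E2 : ev e1 (App parE [:: Var 2; App aroundE [:: Var 2; Var 0]]) =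
    par f (around G e v).
  by rewrite (@ev_app2 _ _ e1 _ (Var 2) _ _ _ erefl E1) ev_par.
have E3 : ev e1 (App endE [:: Var 2; Var 0]) = (v \in e) by exact: ev_end.
rewrite (ev_not (ev_eq E2 E3)).
by case: (par _ _); case: (v \in e).
Qed.

Lemma ev_avoidable : ev [::] avoidableE = avoidable G f e.
Proof.
rewrite (ev_app1 _ ev_size); exact: ev_and ev_components ev_piece.
Qed.
End GraphSpec.

(** * Reading the encoding of an instance *)

(* Unification must not unfold the whole procedure. *)
Local Opaque avoidableE.

Lemma nth_allpairs (S T R : Type) (h : S -> T -> R) (s : seq S) (t : seq T) x0 y0 z i j :
  i < size s -> j < size t ->
  nth z [seq h x y | x <- s, y <- t] (i * size t + j) = h (nth x0 s i) (nth y0 t j).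
Proof.
elim: s i => // a s IH [|i] /= si tj; rewrite nth_cat size_map.
  by rewrite add0n tj (nth_map y0).
by rewrite mulSn -addnA ltnNge leq_addr addKn IH.
Qed.

Lemma nth_map_enum n (T : Type) (h : 'I_n -> T) z (a : 'I_n) :
  nth z [seq h x | x <- enum 'I_n] a = h a.
Proof. by rewrite (nth_map a _ h (s := enum 'I_n)) ?nth_ord_enum // size_enum_ord. Qed.

Section Encoding.
Variable I : instance.
Let n := num_vertices I.
Notation w := (encode I).

Lemma size_encode : size w = n + (1 + (n * n + (n + n))).
Proof.
rewrite /encode -/n; move: (enum 'I_n) (size_enum_ord n) => V sV.
by rewrite !size_cat size_allpairs !size_map size_nseq sV.
Qed.

Lemma num_vertices_gt1 : 1 < n.
Proof.
case/imsetP: (edge_in I) => -[x y]; rewrite inE /= => /adj_neq.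
by have := ltn_ord x; have := ltn_ord y; rewrite -/n -val_eqE /=; lia.
Qed.

Lemma nth_encode_unary i : i < n -> nth false w i.
Proof. by move=> ni; rewrite nth_cat size_nseq ni nth_nseq ni. Qed.

Lemma nth_encode_stop : nth false w n = false.
Proof. by rewrite nth_cat size_nseq ltnn subnn. Qed.

Lemma nth_encode_edge (a b : 'I_n) :
  nth false w (n + 1 + a * n + b) = input_graph I a b.
Proof.
have lt : a * n + b < n * n.
  by have := ltn_ord a; have := ltn_ord b; nia.
rewrite -!addnA /encode nth_cat size_nseq ltnNge leq_addr addKn.
rewrite nth_cat /= addKn nth_cat size_allpairs size_enum_ord lt.
have := @nth_allpairs _ _ _ (input_graph I) (enum 'I_n) (enum 'I_n) a a false a b.
by rewrite size_enum_ord !nth_ord_enum => ->.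
Qed.

Lemma nth_encode_label (a : 'I_n) :
  nth false w (n + 1 + n * n + a) = parity_fun I a.
Proof.
rewrite -!addnA /encode nth_cat size_nseq ltnNge leq_addr addKn.
rewrite nth_cat /= addKn nth_cat size_allpairs size_enum_ord ltnNge leq_addr addKn.
by rewrite nth_cat size_map size_enum_ord ltn_ord nth_map_enum.
Qed.

Lemma nth_encode_end (a : 'I_n) :
  nth false w (n + 1 + n * n + n + a) = (a \in input_edge I).
Proof.
rewrite -!addnA /encode nth_cat size_nseq ltnNge leq_addr addKn.
rewrite nth_cat /= addKn nth_cat size_allpairs size_enum_ord ltnNge leq_addr addKn.
rewrite nth_cat size_map size_enum_ord ltnNge leq_addr addKn.
exact: nth_map_enum.
Qed.

End Encoding.

Theorem theorem9 :
  poly_time_decidable encode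
    (fun I : instance =>
       exists H : sgraph 'I_(num_vertices I),
         parity_perfect_forest (input_graph I) (parity_fun I) H /\
         input_edge I \notin edges H).
Proof.
apply: (expr_poly_time (e := avoidableE)) => [I|I rd rdE].
  exact: nth_encode_unary (ltnW (num_vertices_gt1 I)).
move: rdE; set w := encode I; set n := num_vertices I => rdE.
have n1 : 1 < n := num_vertices_gt1 I.
have sz : size w = _ := size_encode I; rewrite -/n in sz.
have -> : eval (size w) rd [::] avoidableE =
    avoidable (input_graph I) (parity_fun I) (input_edge I).
  apply: ev_avoidable => //; rewrite -/n.
  - by rewrite sz; lia.
  - move=> i /andP[i1 ni]; rewrite rdE ?nth_encode_unary //.
    by rewrite sz; lia.
  - by rewrite rdE ?nth_encode_stop // sz; lia.
  - move=> a b; rewrite -(nth_encode_edge a b) -/n -/w -rdE.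
      by congr rd; lia.
    by rewrite sz; have := ltn_ord a; have := ltn_ord b; rewrite -/n; nia.
  - move=> a; rewrite -(nth_encode_label a) -/n -/w -rdE.
      by congr rd; lia.
    by rewrite sz; have := ltn_ord a; rewrite -/n; lia.
  - move=> a; rewrite -(nth_encode_end a) -/n -/w -rdE.
      by congr rd; lia.
    by rewrite sz; have := ltn_ord a; rewrite -/n; lia.
rewrite lt0b; apply: iff_sym; apply: avoidableP; exact: edge_in.
Qed.
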